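(* If $G$ is an indifference graph with associated Hessenberg function $\mathbf{m}$, then \[ \omega(\mathrm{csf}_q(G))=\sum_{\sigma\leq \mathbf{m}}q^{\mathrm{wt}_G(\sigma)}\rho_{\lambda(\sigma)}=\sum_{\lambda\vdash n}c_{\lambda}(G)\rho_{\lambda}. \]
   Context: A Hessenberg function is a non-decreasing $\mathbf{m}\colon[n]\to[n]$ with $\mathbf{m}(i)\geq i$; its indifference graph $G=G_{\mathbf{m}}$ has vertex set $[n]$ and edges $\{i,j\}$ with $i<j\leq \mathbf{m}(i)$. The chromatic quasisymmetric function is $\mathrm{csf}_q(G)=\sum_{\kappa}q^{\mathrm{asc}_G(\kappa)}x_\kappa$, summing over proper colorings $\kappa\colon[n]\to\mathbb{N}$, where $x_\kappa=\prod_v x_{\kappa(v)}$ and $\mathrm{asc}_G(\kappa)=|\{(i,j): i<j,\ \kappa(i)<\kappa(j),\ \{i,j\}\in E(G)\}|$. $\omega$ is the standard involution on symmetric functions with $\omega(e_n)=h_n$. Let $[j]_q=(q^j-1)/(q-1)$. The symmetric functions $\rho_n\in\Lambda[q]$ are defined by $[n]_qh_n=\sum_{i=1}^n h_{n-i}\rho_i$ (equivalently $\rho_n=q^{n-1}P_n(q^{-1})$, $P_n$ the Hall–Littlewood polynomial), and $\rho_\lambda=\prod_i\rho_{\lambda_i}$. For $\sigma\in S_n$, $\sigma\leq\mathbf{m}$ means $\sigma(i)\leq \mathbf{m}(i)$ for all $i$; $\lambda(\sigma)$ is the cycle type of $\sigma$; $\sigma^c$ is the word obtained by writing $\sigma$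 in cycle notation (each cycle starting with its least element, cycles ordered by least element) and erasing parentheses. A $G$-inversion of a permutation (word) $\tau$ is a pair of positions $i<j$ with $\tau(i)>\tau(j)$ and $\{\tau(i),\tau(j)\}\in E(G)$; $\mathrm{wt}_G(\sigma)$ is the number of $G$-inversions of $\sigma^c$. The coefficients $c_\lambda(G)$ are defined by the second equality, i.e. $c_\lambda(G)=\sum_{\sigma\leq\mathbf{m},\ \lambda(\sigma)=\lambda}q^{\mathrm{wt}_G(\sigma)}$. *)

(* Defs.v *)
From HB Require Import structures.
From mathcomp Require Import all_boot all_order all_algebra all_fingroup.
From mathcomp Require Import boolp.
From mathcomp Require Import mpoly zify.

Set Implicit Arguments.
Unset Strict Implicit.
Unset Printing Implicit Defensive.

Import GRing.Theory.
Local Open Scope ring_scope.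

(** * Symmetric functions in countably many variables x_0, x_1, ... *)

Section LimPoly.
Variable R : comNzRingType.

Definition last_to0 N : N.+1.-tuple {mpoly R[N]} :=
  [tuple if unlift ord_max i is Some j then 'X_j else 0 | i < N.+1].

Definition drop_var N (p : {mpoly R[N.+1]}) : {mpoly R[N]} := p \mPo last_to0 N.

HB.instance Definition _ N :=
  GRing.LRMorphism.copy (@drop_var N) (comp_mpoly (last_to0 N)).

(* A formal series in x_0, x_1, ... is represented by its truncations, i.e.   *)
(* as an element of the inverse limit of the R[x_0, ..., x_(N-1)]; the N-th   *)
(* one is obtained by setting x_i = 0 for all i >= N.                         *)
Record limpoly := LimPoly {
  trunc :> forall N, {mpoly R[N]};
  truncP : forall N, drop_var (trunc N.+1) = trunc N }.

Lemma limpolyP (f g : limpoly) : (forall N, f N = g N) -> f = g.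
Proof.
case: f g => [f fP] [g gP] /= eqfg.
have /= efg := functional_extensionality_dep eqfg; subst g.
by congr LimPoly; apply: Prop_irrelevance.
Qed.

HB.instance Definition _ := gen_eqMixin limpoly.
HB.instance Definition _ := gen_choiceMixin limpoly.

Program Definition limpoly_zero := @LimPoly (fun N => 0) _.
Next Obligation. exact: raddf0. Qed.
Program Definition limpoly_opp (f : limpoly) := @LimPoly (fun N => - f N) _.
Next Obligation. by rewrite raddfN /= truncP. Qed.
Program Definition limpoly_add (f g : limpoly) :=
  @LimPoly (fun N => f N + g N) _.
Next Obligation. by rewrite raddfD /= !truncP. Qed.
Program Definition limpoly_one := @LimPoly (fun N => 1) _.
Next Obligation. exact: rmorph1. Qed.
Program Definition limpoly_mul (f g : limpoly) :=
  @LimPoly (fun N => f N * g N) _.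
Next Obligation. by rewrite rmorphM /= !truncP. Qed.
Program Definition limpoly_scale (c : R) (f : limpoly) :=
  @LimPoly (fun N => c *: f N) _.
Next Obligation. by rewrite linearZ /= !truncP. Qed.

Fact limpoly_addA : associative limpoly_add.
Proof. by move=> f g h; apply: limpolyP => N /=; rewrite addrA. Qed.
Fact limpoly_addC : commutative limpoly_add.
Proof. by move=> f g; apply: limpolyP => N /=; rewrite addrC. Qed.
Fact limpoly_add0 : left_id limpoly_zero limpoly_add.
Proof. by move=> f; apply: limpolyP => N /=; rewrite add0r. Qed.
Fact limpoly_addN : left_inverse limpoly_zero limpoly_opp limpoly_add.
Proof. by move=> f; apply: limpolyP => N /=; rewrite addNr. Qed.
HB.instance Definition _ := GRing.isZmodule.Build limpoly
  limpoly_addA limpoly_addC limpoly_add0 limpoly_addN.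

Fact limpoly_mulA : associative limpoly_mul.
Proof. by move=> f g h; apply: limpolyP => N /=; rewrite mulrA. Qed.
Fact limpoly_mulC : commutative limpoly_mul.
Proof. by move=> f g; apply: limpolyP => N /=; rewrite mulrC. Qed.
Fact limpoly_mul1 : left_id limpoly_one limpoly_mul.
Proof. by move=> f; apply: limpolyP => N /=; rewrite mul1r. Qed.
Fact limpoly_mulD : left_distributive limpoly_mul +%R.
Proof. by move=> f g h; apply: limpolyP => N /=; rewrite mulrDl. Qed.
Fact limpoly_one_neq0 : limpoly_one != 0.
Proof.
by apply/eqP => /(congr1 (fun f : limpoly => f 0)) /eqP; rewrite oner_eq0.
Qed.
HB.instance Definition _ := GRing.Zmodule_isComNzRing.Build limpoly
  limpoly_mulA limpoly_mulC limpoly_mul1 limpoly_mulD limpoly_one_neq0.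

Fact limpoly_scaleA c d f :
  limpoly_scale c (limpoly_scale d f) = limpoly_scale (c * d) f.
Proof. by apply: limpolyP => N /=; rewrite scalerA. Qed.
Fact limpoly_scale1 : left_id 1 limpoly_scale.
Proof. by move=> f; apply: limpolyP => N /=; rewrite scale1r. Qed.
Fact limpoly_scaleDr : right_distributive limpoly_scale +%R.
Proof. by move=> c f g; apply: limpolyP => N /=; rewrite scalerDr. Qed.
Fact limpoly_scaleDl f : {morph limpoly_scale^~ f : c d / c + d}.
Proof. by move=> c d; apply: limpolyP => N /=; rewrite scalerDl. Qed.
HB.instance Definition _ := GRing.Zmodule_isLmodule.Build R limpoly
  limpoly_scaleA limpoly_scale1 limpoly_scaleDr limpoly_scaleDl.
Fact limpoly_scaleAl (c : R) (f g : limpoly) : c *: (f * g) = c *: f * g.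
Proof. by apply: limpolyP => N; apply: scalerAl. Qed.
HB.instance Definition _ :=
  GRing.Lmodule_isLalgebra.Build R limpoly limpoly_scaleAl.
HB.instance Definition _ := GRing.Lalgebra_isComAlgebra.Build R limpoly.

Definition truncN N (f : limpoly) := f N.
Fact truncN_linear N : linear (truncN N). Proof. by []. Qed.
HB.instance Definition _ N :=
  GRing.isLinear.Build R limpoly {mpoly R[N]} _ (truncN N) (@truncN_linear N).
Fact truncN_monoid N : monoid_morphism (truncN N). Proof. by []. Qed.
HB.instance Definition _ N :=
  GRing.isMonoidMorphism.Build limpoly {mpoly R[N]} (truncN N) (@truncN_monoid N).

Definition is_symfun (f : limpoly) :=
  (forall N, f N \is symmetric) /\ (exists d, forall N, (msize (f N) <= d)%N).

End LimPoly.

Section DropVar.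
Variable R : comNzRingType.

Lemma lift_max_widen N (j : 'I_N) : lift ord_max j = widen_ord (leqnSn N) j.
Proof. by apply: val_inj; rewrite /= /bump leqNgt ltn_ord. Qed.

Lemma drop_varX N (m' : 'X_{1..N.+1}) (m : 'X_{1..N}) :
  (drop_var 'X_[R, m'])@_m = 'X_[R, m']@_(mnmwiden m).
Proof.
rewrite mcoeffX /drop_var comp_mpolyX big_ord_recr /= tnth_mktuple unlift_none.
have -> : \prod_(i < N) tnth (last_to0 R N) (widen_ord (leqnSn N) i)
            ^+ m' (widen_ord (leqnSn N) i)
        = 'X_[R, [multinom m' (widen_ord (leqnSn N) i) | i < N]].
  rewrite mpolyXE_id; apply: eq_bigr => i _; rewrite tnth_mktuple mnmE.
  by rewrite -lift_max_widen liftK.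
case: (posnP (m' ord_max)) => [m'0|m'_gt0].
  rewrite m'0 expr0 mulr1 mcoeffX; congr (nat_of_bool _)%:R.
  apply/eqP/eqP => [<-|->]; apply/mnmP => i.
    case: (unliftP ord_max i) => [j ->|->]; last by rewrite mnmwiden_ordmax.
    by rewrite lift_max_widen mnmwiden_widen mnmE.
  by rewrite mnmE mnmwiden_widen.
rewrite expr0n -[m' _ == 0%N]negbK -lt0n m'_gt0 mulr0 mcoeff0.
by case: eqP m'_gt0 => // ->; rewrite mnmwiden_ordmax.
Qed.

Lemma mcoeff_drop_var N (p : {mpoly R[N.+1]}) m :
  (drop_var p)@_m = p@_(mnmwiden m).
Proof.
elim/mpolyind: p => [|c m' p _ _ IH]; first by rewrite raddf0 !mcoeff0.
by rewrite linearP /= !mcoeffD !mcoeffZ IH drop_varX.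
Qed.

Lemma mdeg_mnmwiden N (m : 'X_{1..N}) : mdeg (mnmwiden m) = mdeg m.
Proof.
rewrite !mdegE big_ord_recr /= mnmwiden_ordmax addn0.
by apply: eq_bigr => i _; rewrite mnmwiden_widen.
Qed.

Lemma mesym_dropP k N : drop_var (mesym N.+1 R k) = mesym N R k.
Proof.
apply/mpolyP => m; rewrite mcoeff_drop_var !mcoeff_mesym /mechar mdeg_mnmwiden.
congr (nat_of_bool (_ && _))%:R; apply/forallP/forallP => [m1 i|m1 i].
  by rewrite -mnmwiden_widen.
case: (unliftP ord_max i) => [j ->|->]; last by rewrite mnmwiden_ordmax.
by rewrite lift_max_widen mnmwiden_widen.
Qed.

Definition mhsym N k : {mpoly R[N]} :=
  \sum_(m : 'X_{1..N < k.+1} | mdeg m == k) 'X_[m].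

Lemma mcoeff_mhsym N k m : (mhsym N k)@_m = (mdeg m == k)%:R.
Proof.
rewrite raddf_sum /=; case: eqP => [km|kNm].
  have ltm : (mdeg m < k.+1)%N by rewrite km.
  rewrite (bigD1 (BMultinom ltm)) /= ?km// mcoeffX eqxx big1 ?addr0// => m'.
  by case/andP=> _; rewrite -val_eqE /= mcoeffX => /negbTE ->.
rewrite big1 // => m' /eqP km'; rewrite mcoeffX; case: eqP => // m'm.
by case: kNm; rewrite -m'm.
Qed.

Lemma mhsym_dropP k N : drop_var (mhsym N.+1 k) = mhsym N k.
Proof.
by apply/mpolyP => m; rewrite mcoeff_drop_var !mcoeff_mhsym mdeg_mnmwiden.
Qed.

End DropVar.

Section Omega.
Variable R : comNzRingType.
Local Notation Lim := (limpoly R).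

Definition sym_e k : Lim := LimPoly (mesym_dropP R k).
Definition sym_h k : Lim := LimPoly (mhsym_dropP R k).

Definition limeval (x : nat -> Lim) M (t : {mpoly R[M]}) : Lim :=
  mmap (GRing.in_alg Lim) (fun i : 'I_M => x i.+1) t.

(* The involution of the ring of symmetric functions: it maps each            *)
(* t(e_1, ..., e_M) to t(h_1, ..., h_M).  Every symmetric function is of that *)
(* form (symfun_sym_e) and the image does not depend on t (omega_limeval).    *)
(* On other series omega takes the junk value 0.                              *)
Definition omega (f : Lim) : Lim :=
  if pselect (exists t : {M & {mpoly R[M]}}, f = limeval sym_e (tagged t))
    is left ft then limeval sym_h (tagged (projT1 (cid ft))) else 0.

Lemma limevalD x M : {morph @limeval x M : s t / s + t}.
Proof. exact: raddfD. Qed.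
Lemma limevalM x M : {morph @limeval x M : s t / s * t}.
Proof. exact: rmorphM. Qed.
Lemma limevalZ x M c : {morph @limeval x M : t / c *: t}.
Proof. by move=> t; rewrite /limeval mmapZ mulr_algl. Qed.
Lemma limeval1 x M : @limeval x M 1 = 1.
Proof. exact: rmorph1. Qed.
Lemma limevalX x M (i : 'I_M) : limeval x 'X_i = x i.+1.
Proof. by rewrite /limeval mmapX mmap1U. Qed.

Lemma limeval_trunc x M (t : {mpoly R[M]}) N :
  limeval x t N = t \mPo [tuple x i.+1 N | i < M].
Proof.
rewrite -[LHS]/(truncN N (limeval x t)) raddf_sum comp_mpolyEX.
apply: eq_bigr => m _; rewrite mulr_algl. rewrite -[LHS]/(t@_m *: truncN N (mmap1 _ m)).
rewrite rmorph_prod comp_mpolyX.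
by congr (_ *: _); apply: eq_bigr => i _; rewrite rmorphXn tnth_mktuple.
Qed.

Definition mwide M M' (le : (M <= M')%N) (t : {mpoly R[M]}) : {mpoly R[M']} :=
  t \mPo [tuple 'X_(widen_ord le i) | i < M].

Lemma limeval_mwide x M M' (le : (M <= M')%N) (t : {mpoly R[M]}) :
  limeval x (mwide le t) = limeval x t.
Proof.
rewrite /mwide comp_mpolyEX (big_morph _ (@limevalD x M') (raddf0 _)).
apply: eq_bigr => m _; rewrite limevalZ mulr_algl comp_mpolyX; congr (_ *: _).
rewrite (big_morph _ (@limevalM x M') (limeval1 x M')).
apply: eq_bigr => i _; rewrite tnth_mktuple -(limevalX x (widen_ord le i)).
exact: rmorphXn.
Qed.

Lemma limeval_sym_e_inj M (t1 t2 : {mpoly R[M]}) :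
  limeval sym_e t1 = limeval sym_e t2 -> t1 = t2.
Proof.
move=> /(congr1 (truncN M)); rewrite /truncN !limeval_trunc.
exact: msym_fundamental_un.
Qed.

Lemma omega_limeval M (t : {mpoly R[M]}) :
  omega (limeval sym_e t) = limeval sym_h t.
Proof.
rewrite /omega; case: pselect => [ft|[]]; last by exists (existT _ M t).
case: cid => -[M' t'] /= et.
pose D := maxn M M'; have [le1 le2] := (leq_maxl M M', leq_maxr M M').
rewrite -(limeval_mwide _ le1) -(limeval_mwide _ le2) in et.
rewrite -(limeval_mwide _ le1) -(limeval_mwide _ le2).
by rewrite (limeval_sym_e_inj et).
Qed.

Lemma symfun_eq0 d (g : Lim) : (forall N, g N \is symmetric) ->
  (forall N, (msize (g N) <= d)%N) -> g d = 0 -> g = 0.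
Proof.
move=> gs gd g0; apply: limpolyP => N /=; change (g N = 0).
have [leNd|/ltnW ledN] := leqP N d.
  rewrite -(subKn leNd); elim: (d - N)%N => [|k IH]; first by rewrite subn0.
  have [lekd|ltdk] := leqP d k.
    by have -> : (d - k.+1 = d - k)%N by lia.
  have gS : g (d - k.+1).+1 = 0 by have -> : ((d - k.+1).+1 = d - k)%N by lia.
  by rewrite -truncP gS raddf0.
rewrite -(subnK ledN); elim: (N - d)%N => [//|k IH]; rewrite addSn.
set n := (k + d)%N in IH *; apply/mpolyP => m; rewrite mcoeff0.
have [ltm|] := ltnP (mdeg m) d; last first.
  move=> dm; apply/eqP; rewrite mcoeff_eq0; apply: msize_mdeg_ge.
  exact: leq_trans dm.
have [i /eqP mi0] : exists i, m i == 0%N.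
  apply/existsP; rewrite -[X in is_true X]negbK negb_exists.
  apply/negP => /forallP m_gt0; move: ltm; rewrite ltnNge mdegE => /negP; apply.
  apply: (@leq_trans (\sum_(i < n.+1) 1)%N).
    by rewrite sum1_card card_ord /n; lia.
  by apply: leq_sum => i _; rewrite lt0n; apply: m_gt0.
rewrite -(msym_coeff _ (tperm i ord_max) (gs n.+1)).
set m' := [multinom _ | _ < _].
pose m1 := [multinom m' (widen_ord (leqnSn n) j) | j < n].
have -> : m' = mnmwiden m1.
  apply/mnmP => j; case: (unliftP ord_max j) => [j' ->|->].
    by rewrite lift_max_widen mnmwiden_widen [RHS]mnmE.
  by rewrite mnmwiden_ordmax mnmE tpermR.
by rewrite -mcoeff_drop_var truncP IH mcoeff0.
Qed.

Lemma limeval_sym_e_sym M (t : {mpoly R[M]}) N : limeval sym_e t N \is symmetric.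
Proof.
rewrite limeval_trunc; apply: mcomp_sym => i.
by rewrite -tnth_nth tnth_mktuple; apply: mesym_sym.
Qed.

Lemma msize_limeval_sym_e M (t : {mpoly R[M]}) N :
  (msize (limeval sym_e t N) <= mweight t)%N.
Proof.
rewrite limeval_trunc comp_mpolyEX.
apply: leq_trans (msize_sum _ _ _) _; apply/bigmax_leqP_seq => m mt _.
apply: leq_trans (msizeZ_le _ _) _.
apply: leq_trans (mmeasure_mnm_lt mnmwgt mt).
suff /dhomogP hom : 'X_[R, m] \mPo [tuple mesym N R i.+1 | i < M]
    \is (mnmwgt m).-homog.
  by rewrite msizeE; apply/bigmax_leqP_seq => m' /hom -> _.
rewrite comp_mpolyX /mnmwgt.
elim/big_rec2: _ => [|i p d _ IH]; first exact: dhomog1.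
by rewrite tnth_mktuple mulnC; apply: dhomogM => //; apply/dhomogMn/dhomog_mesym.
Qed.

Lemma symfun_sym_e (f : Lim) :
  is_symfun f <-> exists M (t : {mpoly R[M]}), f = limeval sym_e t.
Proof.
split=> [[fs [d fd]]|[M [t ->]]]; last first.
  split; first exact: limeval_sym_e_sym.
  by exists (mweight t) => N; apply: msize_limeval_sym_e.
have [t [ft wt]] := sym_fundamental (fs d); exists d, t.
apply/eqP; rewrite -subr_eq0; apply/eqP; apply: (@symfun_eq0 d).
- move=> N; change (f N - limeval sym_e t N \is symmetric).
  exact: rpredB (fs N) (limeval_sym_e_sym _ _).
- move=> N; apply: leq_trans (msizeD_le _ _) _; rewrite geq_max fd msizeN /=.
  apply: leq_trans (msize_limeval_sym_e _ _) _; exact: leq_trans wt (fd d).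
- by rewrite -[LHS]/(f d - limeval sym_e t d) limeval_trunc ft subrr.
Qed.

Lemma symfun_sym_e2 (f g : Lim) : is_symfun f -> is_symfun g ->
  exists M (s t : {mpoly R[M]}), f = limeval sym_e s /\ g = limeval sym_e t.
Proof.
move=> /symfun_sym_e[M [s ->]] /symfun_sym_e[M' [t ->]].
exists (maxn M M'), (mwide (leq_maxl M M') s), (mwide (leq_maxr M M') t).
by rewrite !limeval_mwide.
Qed.

Lemma omegaD f g : is_symfun f -> is_symfun g ->
  omega (f + g) = omega f + omega g.
Proof.
move=> fs gs; have [M [s [t [-> ->]]]] := symfun_sym_e2 fs gs.
by rewrite -limevalD !omega_limeval limevalD.
Qed.

Lemma omegaM f g : is_symfun f -> is_symfun g ->
  omega (f * g) = omega f * omega g.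
Proof.
move=> fs gs; have [M [s [t [-> ->]]]] := symfun_sym_e2 fs gs.
by rewrite -limevalM !omega_limeval limevalM.
Qed.

Lemma omegaZ c f : is_symfun f -> omega (c *: f) = c *: omega f.
Proof.
move=> /symfun_sym_e[M [t ->]].
by rewrite -limevalZ !omega_limeval limevalZ.
Qed.

Lemma omega1 : omega 1 = 1.
Proof. by have := omega_limeval (1 : {mpoly R[0]}); rewrite !limeval1. Qed.

Lemma omega_sym_e k : omega (sym_e k) = sym_h k.
Proof.
case: k => [|k]; last first.
  by rewrite -(limevalX sym_e (@ord_max k)) omega_limeval limevalX.
have -> : sym_e 0 = 1 by apply: limpolyP => N; apply: mesym0E.
rewrite omega1; apply: limpolyP => N; apply/mpolyP => m.
by rewrite mcoeff_mhsym mdeg_eq0 mcoeff1 eq_sym.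
Qed.

End Omega.

(** * Integer partitions and cycle types *)

Definition is_intpart n (s : seq nat) :=
  [&& sorted geq s, 0%N \notin s & sumn s == n].

Record intpart n := IntPart { parts :> seq nat; _ : is_intpart n parts }.
HB.instance Definition _ n := [isSub for @parts n].
HB.instance Definition _ n := [Countable of intpart n by <:].

Section IntPartFinite.
Variable n : nat.

Definition intpart_enum : seq (intpart n) :=
  undup (pmap insub [seq map val (val s) | s : n.-bseq 'I_n.+1]).

Lemma intpart_enumP : Finite.axiom intpart_enum.
Proof.
move=> la; rewrite count_uniq_mem ?undup_uniq // mem_undup mem_pmap_sub.
case: la => s /= /and3P[_ s0 /eqP sn].
have size_le : (size s <= n)%N.
  rewrite -sn; elim: s s0 {sn} => //= x s IH; rewrite inE negb_or => /andP[x0 s0].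
  by have := IH s0; lia.
have s_le x : x \in s -> (x < n.+1)%N.
  rewrite -sn ltnS; elim: s {s0 sn size_le} => //= y s IH.
  by rewrite inE => /predU1P[->|/IH]; lia.
suff -> : s \in [seq map val (val s) | s : n.-bseq 'I_n.+1] by [].
have tP : (size [seq inord i : 'I_n.+1 | i <- s] <= n)%N by rewrite size_map.
apply/mapP; exists (Bseq tP); first by rewrite mem_enum.
by rewrite /= -map_comp map_id_in // => i /s_le /inordK.
Qed.

HB.instance Definition _ := isFinite.Build (intpart n) intpart_enumP.

End IntPartFinite.

Lemma partition_porbits n (s : 'S_n) : partition (porbits s) [set: 'I_n].
Proof.
apply/and3P; split.
- rewrite eqEsubset subsetT /=; apply/subsetP => x _.
  by apply/bigcupP; exists (porbit s x); [apply: imset_f|apply: porbit_id].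
- apply/trivIsetP => _ _ /imsetP[x _ ->] /imsetP[y _ ->]; apply: contraR.
  case/pred0Pn=> z /= /andP[]; rewrite -!eq_porbit_mem => /eqP <- /eqP ->.
  exact: eqxx.
- apply/imsetP => -[x _ /setP/(_ x)]; by rewrite porbit_id inE.
Qed.

Lemma cycle_typeP n (s : 'S_n) :
  is_intpart n (sort geq [seq #|C| | C : {set 'I_n} <- enum (porbits s)]).
Proof.
have partP := partition_porbits s.
apply/and3P; split.
- by apply: sort_sorted => i j; apply: leq_total.
- rewrite mem_sort; apply/mapP => -[C]; rewrite mem_enum => Cs /esym/eqP.
  rewrite cards_eq0 => /eqP C0; case/and3P: partP => _ _.
  by rewrite -C0 Cs.
- rewrite (perm_sumn (permEl (perm_sort _ _))) sumnE big_map big_enum /=.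
  by rewrite -(card_partition partP) cardsT card_ord.
Qed.

Definition cycle_type n (s : 'S_n) : intpart n := IntPart (cycle_typeP s).

(** * Indifference graphs, with vertex set 'I_n = {0, ..., n - 1} *)

Definition hessenberg n (m : 'I_n -> 'I_n) :=
  (forall i j : 'I_n, (i <= j)%N -> (m i <= m j)%N) /\
  (forall i : 'I_n, (i <= m i)%N).

Definition indiff n (m : 'I_n -> 'I_n) : rel 'I_n :=
  [rel i j : 'I_n | (i < j <= m i)%N || (j < i <= m j)%N].

Definition perm_le n (s : 'S_n) (m : 'I_n -> 'I_n) :=
  [forall i, (s i <= m i)%N].

(* orbit s i lists i, s i, s (s i), ...; the i kept are the least elements of *)
(* their cycles.                                                              *)
Definition cycle_word n (s : 'S_n) : seq 'I_n :=
  flatten [seq fingraph.orbit s i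
          | i <- enum 'I_n & [forall j in porbit s i, (i <= j)%N]].

Definition ginv n (G : rel 'I_n) (w : seq 'I_n) : nat :=
  let t := tnth (in_tuple w) in
  #|[set p : 'I_(size w) * 'I_(size w)
    | [&& (p.1 < p.2)%N, (t p.2 < t p.1)%N & G (t p.1) (t p.2)]]|.

Definition wt n (G : rel 'I_n) (s : 'S_n) : nat := ginv G (cycle_word s).

(** * Chromatic quasisymmetric functions, over Z[q] with q = 'X *)

Notation Zq := {poly int}.

Section Csf.
Variables (n : nat) (G : rel 'I_n).

Definition proper_coloring N (k : {ffun 'I_n -> 'I_N}) :=
  [forall i, forall j, G i j ==> (k i != k j)].

Definition asc N (k : {ffun 'I_n -> 'I_N}) : nat :=
  #|[set p : 'I_n * 'I_n | [&& (p.1 < p.2)%N, (k p.1 < k p.2)%N & G p.1 p.2]]|.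

(* Setting x_i = 0 for i >= N leaves the colorings with colors < N. *)
Definition csfq_trunc N : {mpoly Zq[N]} :=
  \sum_(k : {ffun 'I_n -> 'I_N} | proper_coloring k)
    ('X : Zq) ^+ asc k *: \prod_(v < n) 'X_(k v).

Lemma csfq_dropP N : drop_var (csfq_trunc N.+1) = csfq_trunc N.
Proof.
pose up (k : {ffun 'I_n -> 'I_N}) : {ffun 'I_n -> 'I_N.+1} :=
  [ffun v => lift ord_max (k v)].
have up_inj : injective up.
  move=> k k' e; apply/ffunP => v; apply: (@lift_inj _ ord_max).
  by have := congr1 (fun f : {ffun _ -> _} => f v) e; rewrite !ffunE.
have drop_prod (k : {ffun 'I_n -> 'I_N.+1}) :
    drop_var (\prod_(v < n) 'X_(k v)) = \prod_(v < n) tnth (last_to0 Zq N) (k v).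
  rewrite rmorph_prod; apply: eq_bigr => v _ /=.
  by rewrite /drop_var comp_mpolyXU -tnth_nth.
rewrite /csfq_trunc raddf_sum /=.
rewrite (bigID (fun k => k \in [set up k | k in [set: {ffun 'I_n -> 'I_N}]])) /=.
rewrite [X in _ + X]big1 ?addr0; last first.
  move=> k /andP[_ kNup]; rewrite linearZ /= drop_prod.
  have [/forallP kmax|] := boolP [forall v, k v != ord_max].
    case/negP: kNup; apply/imsetP.
    have kup v : {j | k v = lift ord_max j}.
      by case: (unliftP ord_max (k v)) (kmax v) => [j ->|->]; [exists j|rewrite eqxx].
    exists [ffun v => sval (kup v)]; first by rewrite inE.
    apply/ffunP => v; rewrite !ffunE.
    exact: (svalP (kup v)).
  rewrite negb_forall => /existsP[v /negbNE/eqP kv].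
  by rewrite (bigD1 v) //= kv tnth_mktuple unlift_none mul0r scaler0.
rewrite (eq_bigl (fun k => (k \in [set up k | k in [set: {ffun 'I_n -> 'I_N}]])
  && proper_coloring k)); last by move=> k; rewrite andbC.
rewrite big_mkcondr big_imset /=; last by move=> ? ? _ _; apply: up_inj.
rewrite -big_mkcondr /=; apply: eq_big => [k|k _].
  rewrite inE /=; apply: eq_forallb => i; apply: eq_forallb => j.
  by rewrite !ffunE (inj_eq lift_inj).
rewrite linearZ /= drop_prod; congr (_ ^+ _ *: _).
  apply: eq_card => -[i j]; rewrite !inE /= !ffunE !lift_max_widen //.
by apply: eq_bigr => v _; rewrite ffunE tnth_mktuple liftK.
Qed.

Definition csfq : limpoly Zq := LimPoly csfq_dropP.

End Csf.

(** * The symmetric functions rho *)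

Definition qint k : Zq := \sum_(i < k) 'X^i.

Lemma qintE k : ('X - 1) * qint k = 'X^k - 1.
Proof. by rewrite subrX1. Qed.

(* rho_seq n = [:: rho_1; ...; rho_n] *)
Fixpoint rho_seq n : seq (limpoly Zq) :=
  if n is k.+1 then
    rcons (rho_seq k) (qint k.+1 *: sym_h _ k.+1
                       - \sum_(i < k) sym_h _ (k - i) * (rho_seq k)`_i)
  else [::].

Definition rho n : limpoly Zq := (rho_seq n)`_n.-1.

Lemma size_rho_seq n : size (rho_seq n) = n.
Proof. by elim: n => //= n IH; rewrite size_rcons IH. Qed.

Lemma nth_rho_seq n i : (i < n)%N -> (rho_seq n)`_i = rho i.+1.
Proof.
elim: n => //= n IH; rewrite ltnS leq_eqVlt => /predU1P[->//|ltin].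
by rewrite nth_rcons size_rho_seq ltin IH.
Qed.

Lemma rhoE n : qint n *: sym_h _ n = \sum_(1 <= i < n.+1) sym_h _ (n - i) * rho i.
Proof.
case: n => [|n]; first by rewrite big_geq // /qint big_ord0 scale0r.
rewrite big_nat_recr //= subnn big_add1 /= big_mkord.
have -> : sym_h Zq 0 = 1.
  apply: limpolyP => N; apply/mpolyP => m.
  by rewrite mcoeff_mhsym mdeg_eq0 mcoeff1 eq_sym.
rewrite mul1r {2}/rho /= nth_rcons size_rho_seq ltnn eqxx addrC.
rewrite [X in _ + X](eq_bigr (fun i : 'I_n => sym_h Zq (n - i) * (rho_seq n)`_i)).
  by rewrite subrK.
by move=> i _; rewrite subSS nth_rho_seq.
Qed.

Definition rho_part (la : seq nat) : limpoly Zq := \prod_(i <- la) rho i.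

Definition ccoef n (m : 'I_n -> 'I_n) (la : intpart n) : Zq :=
  \sum_(s : 'S_n | perm_le s m && (cycle_type s == la)) 'X ^+ wt (indiff m) s.

(** * Symmetry of csfq for indifference graphs *)

(* Two adjacent colours are exchanged on the odd components of the subgraph   *)
(* they induce; these components are increasing paths, so an odd one has as   *)
(* many ascents as descents.                                                  *)

Section CsfSym.
Variables (n : nat) (m : 'I_n -> 'I_n).
Hypothesis hm : hessenberg m.
Local Notation G := (indiff m).

Let m_mono (i j : 'I_n) : (i <= j)%N -> (m i <= m j)%N.
Proof. by case: hm => h _; apply: h. Qed.

Let G_sym : ssrbool.symmetric G.
Proof. by move=> i j; rewrite /indiff /= orbC. Qed.

Let G_lt (i j : 'I_n) : (i < j)%N -> G i j = (j <= m i)%N.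
Proof. by move=> lt; rewrite /indiff /= lt (ltnNge j) (ltnW lt) /= orbF. Qed.

Section Swap.
Variables (N : nat) (a b : 'I_N).
Hypothesis bE : b = a.+1 :> nat.
Implicit Type k : {ffun 'I_n -> 'I_N}.

Let abN : a != b.
Proof. by rewrite -val_eqE /= bE; lia. Qed.

Let S k (v : 'I_n) := (k v == a) || (k v == b).
Let H k : rel 'I_n := [rel u v | [&& G u v, S k u & S k v]].
Let cc k (v : 'I_n) : {set 'I_n} := [set u | connect (H k) v u].
Let oddc k (v : 'I_n) := odd #|cc k v|.
Let phi k : {ffun 'I_n -> 'I_N} :=
  [ffun v => if oddc k v then tperm a b (k v) else k v].

Let tS x : ((tperm a b x == a) || (tperm a b x == b)) = ((x == a) || (x == b)).
Proof. by case: tpermP => [->|->|/eqP/negbTE -> /eqP/negbTE ->]; rewrite ?eqxx ?orbT. Qed.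

Let phiS k : S (phi k) =1 S k.
Proof. by move=> v; rewrite /S ffunE; case: ifP => // _; rewrite tS. Qed.

Let phiH k : H (phi k) =2 H k.
Proof. by move=> u v; rewrite /H /= !phiS. Qed.

Let phi_odd k : oddc (phi k) =1 oddc k.
Proof.
move=> v; rewrite /oddc; congr odd; apply: eq_card => u; rewrite !inE.
exact: eq_connect (phiH k) _ _.
Qed.

Let phiK : involutive phi.
Proof.
move=> k; apply/ffunP => v; rewrite ffunE phi_odd.
by rewrite ffunE; case: (oddc k v); rewrite // tpermK.
Qed.

Let H_sym k : ssrbool.symmetric (H k).
Proof. by move=> u v; rewrite /H /= (G_sym u) [S k u && _]andbC. Qed.

Let H_csym k : connect_sym (H k).
Proof. exact: sym_connect_sym (H_sym k). Qed.

Let cc_eq k u v : connect (H k) u v -> cc k u = cc k v.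
Proof.
by move=> uv; apply/setP => w; rewrite !inE (same_connect (H_csym k) uv).
Qed.

Let phiN k v : ~~ S k v -> phi k v = k v.
Proof.
rewrite /S negb_or ffunE => /andP[va vb]; case: ifP => // _.
by rewrite tpermD // eq_sym.
Qed.

Let phi_proper k : proper_coloring G k -> proper_coloring G (phi k).
Proof.
move=> /forallP kp; apply/forallP => u; apply/forallP => v; apply/implyP => uv.
have kuv : k u != k v by have /forallP/(_ v)/implyP := kp u; apply.
have [uS|uS] := boolP (S k u); have [vS|vS] := boolP (S k v).
- have e : oddc k u = oddc k v.
    by rewrite /oddc (@cc_eq k u v) //; apply: connect1; rewrite /H /= uv uS.
  by rewrite !ffunE e; case: ifP => _ //; rewrite (inj_eq perm_inj).
- rewrite [phi k v]phiN //; apply: contra vS; rewrite /S => /eqP <-.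
  by rewrite [_ || _]phiS.
- rewrite [phi k u]phiN //; apply: contra uS; rewrite /S => /eqP ->.
  by rewrite [_ || _]phiS.
- by rewrite !phiN.
Qed.

Section Comp.
Variables (k : {ffun 'I_n -> 'I_N}) (v0 : 'I_n).
Hypothesis kp : proper_coloring G k.
Hypothesis v0S : S k v0.
Let C := cc k v0.

Let kpP u v : G u v -> k u != k v.
Proof. by have /forallP/(_ u)/forallP/(_ v)/implyP := kp. Qed.

Let CS u : u \in C -> S k u.
Proof.
have cl : closed (H k) (S k).
  by move=> x y /and3P[_ xS yS]; rewrite -!topredE /= xS yS.
by rewrite inE => cu; have := closed_connect cl cu; rewrite -!topredE /= v0S => <-.
Qed.

Let CH u v : u \in C -> H k u v -> v \in C.
Proof. by rewrite !inE => cu /connect1; apply: connect_trans. Qed.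

Let v0C : v0 \in C. Proof. by rewrite inE connect0. Qed.

Let top := [arg max_(u > v0 in C) (u : nat)].
Let bot := [arg min_(u < v0 in C) (u : nat)].

Let topP : top \in C /\ (forall u, u \in C -> (u <= top)%N).
Proof. by rewrite /top; case: arg_maxnP => // i iC im; split=> // u /im. Qed.
Let botP : bot \in C /\ (forall u, u \in C -> (bot <= u)%N).
Proof. by rewrite /bot; case: arg_minnP => // i iC im; split=> // u /im. Qed.

Let same_color u v w : G u v -> G u w -> S k u -> S k v -> S k w -> k v = k w.
Proof.
move=> /kpP uv /kpP uw; rewrite /S => /orP[]/eqP uE /orP[]/eqP vE /orP[]/eqP wE;
  by rewrite vE wE // in uv uw *; move: uv uw; rewrite uE ?eqxx.
Qed.

Let connectC u v : u \in C -> v \in C -> connect (H k) u v.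
Proof. by rewrite !inE (H_csym k v0 u); apply: connect_trans. Qed.

Let upper u : u \in C ->
  (\sum_(v | S k v) ((u < v)%N && G u v))%N = (u != top).
Proof.
move=> uC; have uS := CS uC.
have [u_top|u_top] /= := eqVneq u top.
  rewrite big1 // => v vS; case: ltnP => //= uv; case: (boolP (G u v)) => // Guv.
  have vC : v \in C by apply: (CH uC); rewrite /H /= Guv uS.
  by have := topP.2 v vC; rewrite -u_top leqNgt uv.
have lt_top : (u < top)%N by rewrite ltn_neqAle u_top topP.2.
have [v /and3P[vS uv Guv]] : exists v, [&& S k v, (u < v)%N & G u v].
  apply/existsP; rewrite -[X in is_true X]negbK negb_exists.
  apply/negP => /forallP noup.
  have cl : closed (H k) [pred w : 'I_n | (w <= u)%N].
    have cl1 x y : H k x y -> (x <= u)%N -> (y <= u)%N.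
      move=> /and3P[Gxy xS yS] xu; rewrite leqNgt; apply/negP => uy.
      have := noup y; rewrite yS uy /= (G_lt uy).
      move: Gxy; rewrite (G_lt (leq_ltn_trans xu uy)) => /leq_trans -> //.
      exact: m_mono.
    move=> x y xy; rewrite !inE; apply/idP/idP; apply: cl1 => //.
    by rewrite H_sym.
  have := closed_connect cl (connectC uC topP.1).
  by rewrite !inE leqnn leqNgt lt_top.
rewrite (bigD1 v) //= uv Guv big1 // => w /andP[wS wv].
case: ltnP => //= uw; case: (boolP (G u w)) => // Guw.
have kvw := same_color Guv Guw uS vS wS.
wlog lt : v w vS uv Guv wS wv uw Guw kvw / (v < w)%N.
  move=> wl; case: (ltngtP v w) => [lt|lt|/val_inj e].
  - exact: (wl v w).
  - by apply: (wl w v) => //; rewrite eq_sym.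
  - by rewrite e eqxx in wv.
have /kpP : G v w.
  by rewrite G_lt //; rewrite G_lt // in Guw; apply: leq_trans Guw (m_mono (ltnW uv)).
by rewrite kvw eqxx.
Qed.

Let lower v : v \in C ->
  (\sum_(u | S k u) ((u < v)%N && G u v))%N = (v != bot).
Proof.
move=> vC; have vS := CS vC.
have [v_bot|v_bot] /= := eqVneq v bot.
  rewrite big1 // => u uS; case: ltnP => //= uv; case: (boolP (G u v)) => // Guv.
  have uC : u \in C by apply: (CH vC); rewrite /H /= G_sym Guv uS vS.
  by have := botP.2 u uC; rewrite -v_bot leqNgt uv.
have lt_bot : (bot < v)%N by rewrite ltn_neqAle eq_sym v_bot botP.2.
have [u /and3P[uS uv Guv]] : exists u, [&& S k u, (u < v)%N & G u v].
  apply/existsP; rewrite -[X in is_true X]negbK negb_exists.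
  apply/negP => /forallP nolow.
  have cl : closed (H k) [pred w : 'I_n | (v <= w)%N].
    have cl1 x y : H k x y -> (v <= x)%N -> (v <= y)%N.
      move=> /and3P[Gxy xS yS] vx; rewrite leqNgt; apply/negP => yv.
      have := nolow y; rewrite yS yv /= (G_lt yv).
      move: Gxy; rewrite G_sym (G_lt (leq_trans yv vx)) => yx.
      by rewrite (leq_trans vx).
    move=> x y xy; rewrite !inE; apply/idP/idP; apply: cl1 => //.
    by rewrite H_sym.
  have := closed_connect cl (connectC vC botP.1).
  by rewrite !inE leqnn leqNgt lt_bot.
rewrite (bigD1 u) //= uv Guv big1 // => w /andP[wS wu].
case: ltnP => //= wv; case: (boolP (G w v)) => // Gwv.
have kuw : k u = k w.
  by apply: (same_color (u := v)) => //; rewrite G_sym.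
wlog lt : u w uS uv Guv wS wu wv Gwv kuw / (u < w)%N.
  move=> wl; case: (ltngtP u w) => [lt|lt|/val_inj e].
  - exact: (wl u w).
  - by apply: (wl w u) => //; rewrite eq_sym.
  - by rewrite e eqxx in wu.
have /kpP : G u w.
  by rewrite G_lt //; rewrite G_lt // in Guv; apply: leq_trans Guv; apply: ltnW.
by rewrite kuw eqxx.
Qed.

Let cnt x := (\sum_(u in C) (k u == x))%N.

Let cntE x y : cnt x = (\sum_(u in C) ((k u == x) && (u != y)) + ((k y == x) && (y \in C)))%N.
Proof.
have [yC|yC] := boolP (y \in C).
  rewrite /cnt (bigD1 y) //= [in RHS](bigD1 y) //= eqxx !andbT andbF add0n addnC.
  by congr addn; apply: eq_bigr => u /andP[_ ->]; rewrite andbT.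
rewrite andbF addn0; apply: eq_bigr => u uC.
have -> : u != y by apply: contraNneq yC => <-.
by rewrite andbT.
Qed.

Let ascC := (\sum_(u in C) \sum_(v | S k v) [&& (u < v)%N, (k u < k v)%N & G u v])%N.
Let dscC := (\sum_(u in C) \sum_(v | S k v) [&& (u < v)%N, (k v < k u)%N & G u v])%N.

Let lt_a u v : G u v -> S k u -> S k v -> ((k u < k v)%N = (k u == a)).
Proof.
move=> /kpP; rewrite /S => uv /orP[]/eqP uE /orP[]/eqP vE; rewrite uE vE ?eqxx /= in uv *.
- by [].
- by rewrite bE ltnSn.
- by rewrite bE eq_sym (negbTE abN); lia.
- by [].
Qed.

Let lt_b u v : G u v -> S k u -> S k v -> ((k u < k v)%N = (k v == b)).
Proof.
move=> /kpP; rewrite /S => uv /orP[]/eqP uE /orP[]/eqP vE; rewrite uE vE ?eqxx /= in uv *.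
- by [].
- by rewrite bE ltnSn.
- by rewrite bE (negbTE abN); lia.
- by [].
Qed.

Let notab u : S k u -> (k u == a) = ~~ (k u == b).
Proof.
by rewrite /S => /orP[]/eqP ->; rewrite eqxx ?(negbTE abN) // eq_sym (negbTE abN).
Qed.

Let asc_up : ascC = (\sum_(u in C) ((k u == a) && (u != top)))%N.
Proof.
apply: eq_bigr => u uC; rewrite -mulnb -upper // big_distrr /=.
apply: eq_bigr => v vS; rewrite mulnb; case: (ltnP u v) => uv; rewrite ?andbF //=.
by have [Guv|] := boolP (G u v); rewrite ?andbF // !andbT (lt_a Guv) // CS.
Qed.

Let dsc_up : dscC = (\sum_(u in C) ((k u == b) && (u != top)))%N.
Proof.
apply: eq_bigr => u uC; rewrite -mulnb -upper // big_distrr /=.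
apply: eq_bigr => v vS; rewrite mulnb; case: (ltnP u v) => uv; rewrite ?andbF //=.
have [Guv|_] := boolP (G u v); last by rewrite !andbF.
have Gvu : G v u by rewrite G_sym.
by rewrite !andbT (lt_b Gvu vS (CS uC)).
Qed.

Let swapC (P : 'I_n -> 'I_n -> bool) : (forall u v, P u v -> G u v) ->
  (\sum_(u in C) \sum_(v | S k v) P u v =
   \sum_(v in C) \sum_(u | S k u) P u v)%N.
Proof.
move=> PG.
have P0 u v : S k u -> S k v -> (u \in C) != (v \in C) -> P u v = false.
  move=> uS vS; apply: contraNF => /PG Guv; apply/eqP; apply/idP/idP => [uC|vC].
    by apply: (CH uC); rewrite /H /= Guv uS.
  by apply: (CH vC); rewrite /H /= G_sym Guv uS vS.
transitivity (\sum_(u in C) \sum_(v in C) P u v)%N.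
  apply: eq_bigr => u uC; rewrite (bigID (mem C)) /= [X in (_ + X)%N]big1 ?addn0.
    by apply: eq_bigl => v; rewrite andb_idl // => /CS.
  by move=> v /andP[vS vC]; rewrite (P0 u v (CS uC) vS) ?uC ?(negbTE vC).
rewrite exchange_big; apply: eq_bigr => v vC.
rewrite [RHS](bigID (mem C)) /= [X in (_ + X)%N]big1 ?addn0.
  by apply: eq_bigl => u; rewrite andb_idl // => /CS.
by move=> u /andP[uS uC]; rewrite (P0 u v uS (CS vC)) ?vC ?(negbTE uC).
Qed.

Let asc_low : ascC = (\sum_(v in C) ((k v == b) && (v != bot)))%N.
Proof.
rewrite /ascC swapC => [|u v /and3P[]//].
apply: eq_bigr => v vC; rewrite -mulnb -lower // big_distrr /=.
apply: eq_bigr => u uS; rewrite mulnb; case: (ltnP u v) => uv; rewrite ?andbF //=.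
by have [Guv|] := boolP (G u v); rewrite ?andbF // !andbT (lt_b Guv) // CS.
Qed.

Let balance : (cnt a = ascC + (k top == a) /\ cnt b = ascC + (k bot == b) /\
  cnt b = dscC + (k top == b) /\ cnt a + cnt b = #|C|)%N.
Proof.
have [tC _] := topP; have [bC _] := botP; split; [|split; [|split]].
- by rewrite (cntE a top) tC andbT asc_up.
- by rewrite (cntE b bot) bC andbT asc_low.
- by rewrite (cntE b top) tC andbT dsc_up.
- rewrite /cnt -big_split /= -sum1_card; apply: eq_bigr => u /CS/notab ->.
  by case: eqP.
Qed.

Lemma comp_even : ~~ odd #|cc k v0| ->
  (\sum_(u in cc k v0) (k u == a) = \sum_(u in cc k v0) (k u == b))%N.
Proof.
rewrite -/C -?/ascC -?/dscC -?/(cnt _).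
have [tC _] := topP; have [bC _] := botP.
have [e1 [e2 [e3 <-]]] := balance; rewrite (notab (CS tC)) in e1.
by case: (k top == b) e1 e3; case: (k bot == b) e2 => /=; lia.
Qed.

Lemma comp_odd : odd #|cc k v0| ->
  (\sum_(u in cc k v0) \sum_(v | S k v) [&& (u < v)%N, (k u < k v)%N & G u v] =
   \sum_(u in cc k v0) \sum_(v | S k v) [&& (u < v)%N, (k v < k u)%N & G u v])%N.
Proof.
rewrite -/C -?/ascC -?/dscC -?/(cnt _).
have [tC _] := topP; have [bC _] := botP.
have [e1 [e2 [e3 <-]]] := balance; rewrite (notab (CS tC)) in e1.
by case: (k top == b) e1 e3; case: (k bot == b) e2 => /=; lia.
Qed.

End Comp.

Let cc1 k v : ~~ S k v -> cc k v = [set v].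
Proof.
move=> vS; apply/setP => u; rewrite !inE; apply/idP/eqP => [vu|->].
  have cl : closed (H k) (pred1 v).
    move=> x y /and3P[_ xS yS]; rewrite !inE.
    have -> : (x == v) = false by apply: contraNF vS => /eqP <-.
    by symmetry; apply: contraNF vS => /eqP <-.
  by have := closed_connect cl vu; rewrite !inE eqxx => /esym/eqP.
exact: connect0.
Qed.

Let root_cc k v0 v : (fingraph.root (H k) v == fingraph.root (H k) v0) = (v \in cc k v0).
Proof. by rewrite (root_connect (H_csym k)) inE H_csym. Qed.

Let oddcE k v0 v : v \in cc k v0 -> oddc k v = oddc k v0.
Proof. by rewrite inE /oddc => /cc_eq ->. Qed.

Let ccS k v0 v : S k v0 -> v \in cc k v0 -> S k v.
Proof.
move=> v0S; rewrite inE H_csym; apply: contraTT => vS.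
by have /setP/(_ v0) := cc1 vS; rewrite !inE => ->; apply: contraTneq v0S => ->.
Qed.

Lemma phi_weight k : proper_coloring G k ->
  \prod_(v < n) 'X_(tperm a b (k v)) =
  \prod_(v < n) 'X_(phi k v) :> {mpoly Zq[N]}.
Proof.
move=> kp; rewrite (partition_big (fingraph.root (H k)) predT) //=.
rewrite [RHS](partition_big (fingraph.root (H k)) predT) //=.
apply: eq_bigr => r _.
have [v0 /eqP <-|no] := pickP (fun v => fingraph.root (H k) v == r); last first.
  by rewrite !big_pred0.
rewrite !(eq_bigl _ _ (root_cc k v0)).
have [odd0|even0] := boolP (oddc k v0).
  by apply: eq_bigr => v vC; rewrite ffunE (oddcE vC) odd0.
have v0S : S k v0.
  by apply: contraNT even0 => /cc1; rewrite /oddc => ->; rewrite cards1.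
have ev := comp_even kp v0S even0.
transitivity (\prod_(u in cc k v0)
    ('X_b ^+ (k u == a) * 'X_a ^+ (k u == b)) : {mpoly Zq[N]}).
  apply: eq_bigr => u /(ccS v0S)/orP[]/eqP ->.
    by rewrite tpermL eqxx (negbTE abN) mulr1.
  by rewrite tpermR eqxx eq_sym (negbTE abN) mul1r.
transitivity (\prod_(u in cc k v0)
    ('X_a ^+ (k u == a) * 'X_b ^+ (k u == b)) : {mpoly Zq[N]}); last first.
  apply: eq_bigr => u uC; rewrite ffunE (oddcE uC) (negbTE even0).
  move: (ccS v0S uC) => /orP[]/eqP ->.
    by rewrite eqxx (negbTE abN) mulr1.
  by rewrite eqxx eq_sym (negbTE abN) mul1r.
by rewrite !big_split /= -!expr_sum ev mulrC.
Qed.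

Let ascE k : asc G k =
  (\sum_(u : 'I_n) \sum_(v : 'I_n) [&& (u < v)%N, (k u < k v)%N & G u v])%N.
Proof.
by rewrite pair_bigA /asc -sum1dep_card big_mkcond /=; apply: eq_bigr => -[u v] _.
Qed.

Let lt_out (x y : 'I_N) : ~~ ((x == a) || (x == b)) ->
  (((x < tperm a b y)%N = (x < y)%N) * ((tperm a b y < x)%N = (y < x)%N)).
Proof.
rewrite -!val_eqE /= bE => xN.
by split; case: tpermP => [->|->|//]; rewrite bE; lia.
Qed.

Let lt_phi k u v : ~~ (S k u && S k v) ->
  (phi k u < phi k v)%N = (k u < k v)%N.
Proof.
have [uS /= vS|uS _] := boolP (S k u).
  by rewrite (phiN vS) ffunE; case: ifP => // _; rewrite (lt_out _ vS).
by rewrite (phiN uS) ffunE; case: ifP => // _; rewrite (lt_out _ uS).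
Qed.

Let lt_swap (x y : 'I_N) : (x == a) || (x == b) -> (y == a) || (y == b) ->
  (tperm a b x < tperm a b y)%N = (y < x)%N.
Proof.
by move=> /orP[]/eqP -> /orP[]/eqP ->; rewrite ?tpermL ?tpermR ?ltnn.
Qed.

Lemma phi_asc k : proper_coloring G k -> asc G (phi k) = asc G k.
Proof.
move=> kp; rewrite !ascE.
rewrite (bigID (S k)) [in RHS](bigID (S k)) /=; congr addn; last first.
  by apply: eq_bigr => u uS; apply: eq_bigr => v _; rewrite lt_phi // (negbTE uS).
pose T (k1 : {ffun 'I_n -> 'I_N}) (u : 'I_n) := (\sum_(v | S k v) [&& (u < v)%N, (k1 u < k1 v)%N & G u v] : nat)%N.
suff eqT : (\sum_(u | S k u) T (phi k) u = \sum_(u | S k u) T k u)%N.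
  under eq_bigr do rewrite (bigID (S k)) /=.
  under [in RHS]eq_bigr do rewrite (bigID (S k)) /=.
  rewrite !big_split /= [X in (X + _)%N]eqT; congr addn.
  apply: eq_bigr => u uS; apply: eq_bigr => v vS.
  by rewrite lt_phi // (negbTE vS) andbF.
rewrite (partition_big (fingraph.root (H k)) predT) //=.
rewrite [RHS](partition_big (fingraph.root (H k)) predT) //=.
apply: eq_bigr => r _.
have [v0 /andP[v0S /eqP <-]|no] :=
  pickP (fun v => S k v && (fingraph.root (H k) v == r)); last first.
  by rewrite !big_pred0.
have eP u : S k u && (fingraph.root (H k) u == fingraph.root (H k) v0)
    = (u \in cc k v0).
  by rewrite root_cc andb_idl // => /(ccS v0S).
rewrite !(eq_bigl _ _ eP).
have [odd0|even0] := boolP (oddc k v0).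
  rewrite [RHS](comp_odd kp v0S odd0).
  apply: eq_bigr => u uC; apply: eq_bigr => v vS.
  have [Guv|_] := boolP (G u v); last by rewrite !andbF.
  have uS := ccS v0S uC.
  have vC : v \in cc k v0.
    move: uC; rewrite !inE => uC; apply: connect_trans uC (connect1 _).
    by rewrite /H /= Guv uS.
  by rewrite !ffunE (oddcE uC) (oddcE vC) odd0 lt_swap.
apply: eq_bigr => u uC; apply: eq_bigr => v vS.
have [Guv|_] := boolP (G u v); last by rewrite !andbF.
have uS := ccS v0S uC.
have vC : v \in cc k v0.
  move: uC; rewrite !inE => uC; apply: connect_trans uC (connect1 _).
  by rewrite /H /= Guv uS.
by rewrite !ffunE (oddcE uC) (oddcE vC) (negbTE even0).
Qed.

Lemma csfq_swap : msym (tperm a b) (csfq_trunc G N) = csfq_trunc G N.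
Proof.
rewrite /csfq_trunc raddf_sum /=.
rewrite [RHS](reindex_inj (inv_inj phiK)) /=.
apply: eq_big => [k|k kp].
  by apply/idP/idP => /phi_proper //; rewrite phiK.
rewrite phi_asc // -phi_weight // linearZ /= rmorph_prod; congr (_ *: _).
by apply: eq_bigr => v _; rewrite /= /msym mmapX mmap1U.
Qed.

End Swap.

Lemma csfq_is_symfun : is_symfun (csfq G).
Proof.
split=> [N|].
  pose K : {set 'S_N} := [set s | msym s (csfq_trunc G N) == csfq_trunc G N].
  have KM s t : s \in K -> t \in K -> (s * t)%g \in K.
    by rewrite !inE msymMm => /eqP -> /eqP ->.
  have K1 : 1%g \in K by rewrite inE msym1m.
  have Kadj (i j : 'I_N) : j = i.+1 :> nat -> tperm i j \in K.
    by move=> ij; rewrite inE csfq_swap.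
  have Klt d (i j : 'I_N) : j = (i + d.+1)%N :> nat -> tperm i j \in K.
    elim: d j => [|d IH] j jE; first by apply: Kadj; rewrite jE addn1.
    have lt' : (i + d.+1 < N)%N by rewrite (leq_trans _ (ltn_ord j)) // jE; lia.
    pose j' := Ordinal lt'.
    have j'j : tperm j' j \in K by apply: Kadj; rewrite jE /=; lia.
    have -> : tperm i j = (tperm j' j * tperm i j' * tperm j' j)%g.
      rewrite -{1}[tperm j' j]tpermV -mulgA -conjgE tpermJ tpermL tpermD //.
        by rewrite -val_eqE /=; lia.
      by rewrite -val_eqE /= jE; lia.
    by rewrite !KM // IH.
  have Kt i j : tperm i j \in K.
    case: (ltngtP i j) => [lt|lt|/val_inj ->]; last by rewrite tperm1.
      by apply: (Klt (j - i).-1); lia.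
    by rewrite tpermC; apply: (Klt (i - j).-1); lia.
  apply/issymP => s; apply/eqP; suff : s \in K by rewrite inE.
  have [ts -> _] := prod_tpermP s.
  by elim/big_ind: _ => // t _; apply: Kt.
exists n.+1 => N; rewrite /= /csfq_trunc.
apply: leq_trans (msize_sum _ _ _) _; apply/bigmax_leqP => k _.
apply: leq_trans (msizeZ_le _ _) _.
by rewrite mprodXE msizeX ltnS mdeg_sum (eq_bigr (fun=> 1%N)) ?sum1_card ?card_ord // => i; rewrite mdeg1.
Qed.

End CsfSym.

(* Main.v *)
(**
For disjoint sets A, B let inv(A, B) be the
number of edges {a > b} with a in A and b in B, and let c(A) be the sum of
q^inv over the cyclic words on A that start at min A and satisfy sigma <= m.
Inserting the vertices of A in increasing order shows that c(A) is the product,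
over the non-minimal vertices v of A, of [d_v]_q with d_v the number of
neighbours of v in A below v.

Splitting off the cycle through the least vertex b, the right-hand side becomes
the solution R of
  R(B) = sum over A in B with b in A of c(A) q^inv(A, B - A) rho_|A| R(B - A),
since the condition sigma <= m and the weight restrict to induced subgraphs.
It remains to see that csf_q satisfies the same recursion, with omega(rho_k) in
place of rho_k.  In finitely many variables, (q - 1) omega(rho_k) is the
coefficient g(k) of z^k in E(qz) / E(z), so that adding a variable x gives
  g'(k) + x g'(k - 1) = g(k) + q x g(k - 1),
while removing the class S of the largest colour gives
  F'(B) = sum over independent S in B of x^|S| q^inv(S, B - S) F(B - S).
By induction on the number of variables, the recursion follows from an identity
between the two polynomials
  T  = sum of c(A) q^inv(A, W - A) x^|W - A| y^|A|,
  T' = sum of c(A) q^inv(W - A, A) x^|W - A| y^|A|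
(A in W containing b, with W - A independent), namely that for some Theta
  T = I x^(|W|-1) y + (x + y) Theta,   T' = I x^(|W|-1) y + (q x + y) Theta,
where I = 1 if W is independent and I = 0 otherwise.
*)

From HB Require Import structures.
From mathcomp Require Import all_boot all_order all_algebra all_fingroup.
From mathcomp Require Import mpoly ring.
Require Import Defs.

Set Implicit Arguments.
Unset Strict Implicit.
Unset Printing Implicit Defensive.

Import GRing.Theory.
Local Open Scope ring_scope.

(** * Sums over subsets *)

Lemma big_subset_setU1 (T : finType) (V : nmodType) (t : T) (W : {set T})
    (f : {set T} -> V) : t \notin W ->
  \sum_(A : {set T} | A \subset t |: W) f A =
  \sum_(A : {set T} | A \subset W) (f (t |: A) + f A).
Proof.
move=> tW; rewrite (bigID (fun A : {set T} => t \in A)) /= big_split /=.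
congr (_ + _).
  rewrite (reindex_onto (fun A => t |: A) (fun A => A :\ t)) /=; last first.
    by move=> A /andP[_ tA]; rewrite setD1K.
  apply: eq_bigl => A; rewrite setU11 andbT.
  apply/andP/idP => [[/subsetP AW /eqP <-]|AW].
    by rewrite subDset; apply/subsetP.
  have tA : t \notin A by apply: contra tW; apply/subsetP.
  by rewrite setU1K // eqxx setUS.
apply: eq_bigl => A; apply/andP/idP => [[/subsetP AW tA]|AW].
  apply/subsetP => u uA; have := AW u uA; rewrite !inE; case: eqP => // ut.
  by rewrite -ut uA in tA.
split; last by apply: contra tW; apply/subsetP.
exact: subset_trans AW (subsetUr _ _).
Qed.

Lemma disjoint_setD (T : finType) (A W : {set T}) : [disjoint A & W :\: A].
Proof. by rewrite -setI_eq0; apply/eqP/setP => u; rewrite !inE; case: (u \in A). Qed.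

Lemma setU_setD (T : finType) (A W : {set T}) : A \subset W -> A :|: (W :\: A) = W.
Proof. by move=> AW; rewrite setDE setUIr setUCr setIT; apply/setUidPr. Qed.

Lemma setD_nest (T : finType) (A W B : {set T}) : A \subset W -> W \subset B ->
  B :\: A :\: (W :\: A) = B :\: W.
Proof.
move=> AW WB; apply/setP => u; rewrite !inE.
by case: (boolP (u \in A)) => [/(subsetP AW) ->|_] //=; rewrite andbT.
Qed.

Lemma setD_split (T : finType) (A W B : {set T}) : A \subset W -> W \subset B ->
  B :\: A = (W :\: A) :|: (B :\: W).
Proof.
move=> AW WB; apply/setP => u; rewrite !inE.
case: (boolP (u \in A)) => [/(subsetP AW) -> //|_] /=.
by case: (boolP (u \in W)) => [/(subsetP WB)|].
Qed.

(** Disjoint pairs (A, S) in B correspond to chains A in W in B through W = A :|: S and S = W :\: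
    A. *)
Lemma big_subset_nest (T : finType) (V : nmodType) (B : {set T})
    (f : {set T} -> {set T} -> V) :
  \sum_(A : {set T} | A \subset B) \sum_(S : {set T} | S \subset B :\: A) f A S =
  \sum_(W : {set T} | W \subset B) \sum_(A : {set T} | A \subset W) f A (W :\: A).
Proof.
rewrite !pair_big_dep /=.
rewrite (reindex_onto (fun p => (p.2, p.1 :\: p.2)) (fun p => (p.1 :|: p.2, p.1))) /=.
  apply: eq_bigl => -[W A] /=; rewrite xpair_eqE eqxx andbT setDE setUIr setUCr setIT.
  have -> : (A :|: W == W) = (A \subset W) by apply/eqP/idP => /setUidPr.
  have [AW|] := boolP (A \subset W); last by rewrite !andbF.
  rewrite !andbT -setDE subDset setDE setUIr setUCr setIT.
  apply/andP/idP => [[AB]|WB]; first by rewrite (setUidPr AB).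
  have AB := subset_trans AW WB.
  by rewrite (setUidPr AB).
move=> [A S] /=; rewrite subsetD => /andP[_ /andP[_ d]].
rewrite setDUl setDv set0U; congr (_, _).
by apply/setDidPl; rewrite disjoint_sym disjoint_sym.
Qed.

Lemma exchange_subset (T : finType) (V : nmodType) (B : {set T})
    (f : {set T} -> {set T} -> V) :
  \sum_(A : {set T} | A \subset B) \sum_(S : {set T} | S \subset B :\: A) f A S =
  \sum_(S : {set T} | S \subset B) \sum_(A : {set T} | A \subset B :\: S) f A S.
Proof.
rewrite (exchange_big_dep (fun S : {set T} => S \subset B)) /=.
  apply: eq_bigr => S SB; apply: eq_bigl => A.
  by rewrite !subsetD SB disjoint_sym; case: (A \subset B).
by move=> A S _; rewrite subsetD => /andP[].
Qed.

(** * Indifference graphs and the splitting identity *)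

Section Indifference.
Variables (n : nat) (m : 'I_n -> 'I_n).
Hypothesis hm : hessenberg m.
Implicit Types (A B K S W : {set 'I_n}) (u v t b : 'I_n).

Definition edge_up : rel 'I_n := [rel u v : 'I_n | (u < v)%N && (v <= m u)%N].

Definition low_nbrs A v := [set u in A | edge_up u v].

(** This is inv(A, B): the inversions between two blocks when the letters of A are written before
    those of B. *)
Definition back_inv A B : nat := \sum_(v in A) #|low_nbrs B v|.

Definition indep S := [forall u in S, forall v in S, ~~ edge_up u v].

(** A clique that is an up-set of W. The lower neighbours of a vertex above W form such a set, and
    removing the largest vertex from such a set leaves another one. *)
Definition top_clique W K :=
  [/\ K \subset W,
      (forall u v, u \in K -> v \in W -> (u <= v)%N -> v \in K) &
      (forall u v, u \in K -> v \in K -> (u < v)%N -> edge_up u v)].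

Lemma edge_upF u v : (v <= u)%N -> edge_up u v = false.
Proof. by rewrite /edge_up /= ltnNge => ->. Qed.

(** Monotonicity of [m] gives the interval property of indifference graphs: v is adjacent to both
    ends of any edge that spans it. *)
Lemma edge_up_trans u v t : (u < v < t)%N -> edge_up u t -> edge_up u v /\ edge_up v t.
Proof.
case: hm => mono _ /andP[uv vt] /andP[_ tu]; split; apply/andP; split=> //.
  by apply: leq_trans tu; apply: ltnW.
by apply: leq_trans tu (mono _ _ (ltnW uv)).
Qed.

Lemma indiffE u v : indiff m u v = edge_up u v || edge_up v u.
Proof. by []. Qed.

Lemma back_inv0 A : back_inv A set0 = 0%N.
Proof.
rewrite /back_inv big1 // => v _; apply/eqP; rewrite cards_eq0 -subset0.
by apply/subsetP => u; rewrite !inE.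
Qed.

Lemma back_inv0l A : back_inv set0 A = 0%N.
Proof. by rewrite /back_inv big_set0. Qed.

Lemma back_invUl A A' B : [disjoint A & A'] ->
  back_inv (A :|: A') B = (back_inv A B + back_inv A' B)%N.
Proof. by move=> d; rewrite /back_inv -bigU //; apply: eq_bigl => v; rewrite !inE. Qed.

Lemma card_low_nbrsU A B v : [disjoint A & B] ->
  #|low_nbrs (A :|: B) v| = (#|low_nbrs A v| + #|low_nbrs B v|)%N.
Proof.
move=> d; rewrite -cardsUI (_ : low_nbrs A v :&: low_nbrs B v = set0) ?cards0 ?addn0.
  by apply: eq_card => u; rewrite !inE andb_orl.
apply/eqP; rewrite -subset0; apply/subsetP => u; rewrite !inE => /andP[/andP[uA _] /andP[uB _]].
by have := disjointFr d uA; rewrite uB.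
Qed.

Lemma back_invUr A B B' : [disjoint B & B'] ->
  back_inv A (B :|: B') = (back_inv A B + back_inv A B')%N.
Proof.
by move=> d; rewrite /back_inv -big_split; apply: eq_bigr => v _; rewrite card_low_nbrsU.
Qed.

(** * Adding a vertex above all others *)

Section AddTop.
Variables (W : {set 'I_n}) (t : 'I_n).
Hypothesis ltW : forall u, u \in W -> (u < t)%N.

Lemma top_notin A : A \subset W -> t \notin A.
Proof. by move=> /subsetP AW; apply/negP => /AW/ltW; rewrite ltnn. Qed.

Lemma low_nbrs_top A v : A \subset W -> v \in W -> low_nbrs (t |: A) v = low_nbrs A v.
Proof.
move=> AW vW; apply/setP => u; rewrite !inE; case: eqP => //= ->.
by rewrite edge_upF ?andbF // ltnW // ltW.
Qed.

Lemma back_inv_topr A S : A \subset W -> S \subset W ->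
  back_inv S (t |: A) = back_inv S A.
Proof.
move=> AW SW; apply: eq_bigr => v vS; rewrite low_nbrs_top //.
by apply: (subsetP SW).
Qed.

Lemma back_inv_topl A S : A \subset W ->
  back_inv (t |: A) S = (#|low_nbrs S t| + back_inv A S)%N.
Proof. by move=> AW; rewrite /back_inv big_setU1 // top_notin. Qed.

Lemma top_clique_low_nbrs : top_clique W (low_nbrs W t).
Proof.
split=> [|u v|u v].
- by apply/subsetP => u; rewrite inE => /andP[].
- rewrite !inE => /andP[uW ut] vW; rewrite vW leq_eqVlt => /predU1P[/val_inj <- //|uv].
  by have [_ ->] := edge_up_trans (introT andP (conj uv (ltW vW))) ut.
- rewrite !inE => /andP[uW ut] /andP[vW vt] uv.
  by have [-> _] := edge_up_trans (introT andP (conj uv (ltW vW))) ut.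
Qed.

(** As an up-set, a nonempty K contains the largest vertex t, and then every other vertex of K is a
    lower neighbour of t. *)
Lemma top_cliqueD1 K : K != set0 -> top_clique (t |: W) K ->
  [/\ t \in K, top_clique W (K :\ t) & K :\ t \subset low_nbrs W t].
Proof.
move=> /set0Pn[k kK] [KW Kup Kcl].
have ltKt u : u \in K -> u != t -> (u < t)%N.
  by move=> /(subsetP KW); rewrite !inE; case: eqP => //= _ /ltW.
have tK : t \in K.
  apply: (Kup k) => //; first by rewrite setU11.
  by case: (eqVneq k t) => [->//|/(ltKt _ kK)/ltnW].
have inW u : u \in K :\ t -> u \in W.
  by rewrite !inE => /andP[ut /(subsetP KW)]; rewrite !inE (negbTE ut).
split=> //.
  split; first by apply/subsetP.
    move=> u v; rewrite !inE => /andP[_ uK] vW uv.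
    have /(Kup u) -> // : v \in t |: W by rewrite !inE vW orbT.
    by rewrite andbT; apply: contraTneq (ltW vW) => ->; rewrite ltnn.
  by move=> u v; rewrite !inE => /andP[_ uK] /andP[_ vK]; apply: Kcl.
apply/subsetP => u uK; rewrite inE inW //=; move: uK; rewrite !inE => /andP[ut uK].
by apply: Kcl => //; apply: ltKt.
Qed.

Lemma indepP S : reflect {in S &, forall u v, ~~ edge_up u v} (indep S).
Proof.
apply: (iffP forall_inP) => [h u v uS vS|h u uS]; first by have /forall_inP := h u uS; apply.
by apply/forall_inP => v vS; apply: h.
Qed.

Lemma indep_top S : S \subset W ->
  indep (t |: S) = indep S && [disjoint low_nbrs W t & S].
Proof.
move=> SW; apply/indepP/andP => [h|[/indepP h d] u v].
  split; first by apply/indepP => u v uS vS; apply: h; rewrite !inE ?uS ?vS orbT.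
  rewrite -setI_eq0 -subset0; apply/subsetP => u; rewrite !inE => /andP[/andP[_ ut] uS].
  by rewrite (negbTE (h u t _ _)) ?setU11 // ?inE ?uS ?orbT in ut.
rewrite !inE => /predU1P[->|uS] /predU1P[->|vS]; first by rewrite edge_upF.
- by rewrite edge_upF // ltnW // ltW // (subsetP SW).
- apply/negP => ut; have := disjointFl d uS; rewrite inE ut andbT.
  by rewrite (subsetP SW).
- exact: h.
Qed.

Lemma card_clique_indep K S : top_clique W K -> indep S -> (#|K :&: S| <= 1)%N.
Proof.
move=> [_ _ cl] /indepP ind; rewrite leqNgt; apply/negP => /card_gt1P[u [v [uK vK]]].
move: uK vK; rewrite !inE => /andP[uK uS] /andP[vK vS].
case: (ltngtP u v) => [uv|vu|/val_inj ->]; last by rewrite eqxx.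
  by have := cl u v uK vK uv; rewrite (negPf (ind u v uS vS)).
by have := cl v u vK uK vu; rewrite (negPf (ind v u vS uS)).
Qed.

End AddTop.

Lemma indep1 b : indep [set b].
Proof. by apply/indepP => u v /set1P -> /set1P ->; rewrite edge_upF. Qed.

(** * Cycle weights and the two splitting sums *)

Section CycleWeight.
Variables (R : comNzRingType) (q : R).

Definition qnum k : R := \sum_(i < k) q ^+ i.

Lemma qnumS k : qnum k.+1 = qnum k + q ^+ k.
Proof. by rewrite /qnum big_ord_recr. Qed.

Lemma qnumSl k : qnum k.+1 = 1 + q * qnum k.
Proof.
rewrite /qnum big_ord_recl expr0; congr (_ + _); rewrite big_distrr /=.
by apply: eq_bigr => i _; rewrite exprS.
Qed.

Lemma qnum0 : qnum 0 = 0. Proof. by rewrite /qnum big_ord0. Qed.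

Lemma qnum_exp k : q ^+ k = 1 + (q - 1) * qnum k.
Proof. by rewrite -subrX1 addrC subrK. Qed.

(** The product formula for c(A) serves as definition; [sum_words] identifies it with the sum over
    cyclic words. *)
Definition cyc_weight b A : R := \prod_(v in A :\ b) qnum #|low_nbrs A v|.

Lemma cyc_weight_top W t b A : (forall u, u \in W -> (u < t)%N) -> A \subset W ->
  b \in W -> cyc_weight b (t |: A) = qnum #|low_nbrs A t| * cyc_weight b A.
Proof.
move=> ltW AW bW; have tA := top_notin ltW AW.
have tb : t != b by apply: contraTneq (ltW b bW) => ->; rewrite ltnn.
rewrite /cyc_weight (bigD1 t) /=; last by rewrite !inE eqxx tb.
congr (_ * _).
  congr qnum; apply: eq_card => u; rewrite !inE; case: eqP => //= ->.
  by rewrite edge_upF // andbF.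
apply: eq_big => [v|v]; rewrite !inE.
  by case: (eqVneq v t) => [->|]; rewrite ?(negbTE tA) ?andbF //= andbT.
case/andP=> /andP[_ /predU1P[->|vA _]]; first by rewrite eqxx.
by rewrite (low_nbrs_top ltW) // (subsetP AW).
Qed.

Variables (b : 'I_n) (x y : R).

(** The sum T restricted to the A that contain K; K = [set0] gives T itself. The conditions sit in
    the summand, so that sums over all A in W can be compared term by term. *)
Definition split_sum W K : R :=
  \sum_(A : {set 'I_n} | A \subset W) (if [&& b \in A, indep (W :\: A) & K \subset A] then
    cyc_weight b A * q ^+ back_inv A (W :\: A) * x ^+ #|W :\: A| * y ^+ #|A|
    else 0).

(** T' restricted in the same way: the block W - A is now written before A. *)
Definition split_sum' W K : R :=
  \sum_(A : {set 'I_n} | A \subset W) (if [&& b \in A, indep (W :\: A) & K \subset A] then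
    cyc_weight b A * q ^+ back_inv (W :\: A) A * x ^+ #|W :\: A| * y ^+ #|A|
    else 0).

(** * Recurrences for the splitting sums *)

Section AddTopSum.
Variables (W : {set 'I_n}) (t : 'I_n).
Hypothesis ltW : forall u, u \in W -> (u < t)%N.
Hypothesis bW : b \in W.
Let N := low_nbrs W t.

Let setD_top_l A : A \subset W -> (t |: W) :\: (t |: A) = W :\: A.
Proof.
move=> AW; apply/setP => u; rewrite !inE negb_or; case: eqP => //= ->.
by rewrite (negbTE (top_notin ltW (subxx W))) andbF.
Qed.

Let setD_top_r A : A \subset W -> (t |: W) :\: A = t |: (W :\: A).
Proof.
move=> AW; apply/setP => u; rewrite !inE; case: eqP => //= ->.
by rewrite (top_notin ltW AW).
Qed.

Let tNb : (t == b) = false.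
Proof. by apply: contraTF (ltW bW) => /eqP ->; rewrite ltnn. Qed.

Let card_low A : A \subset W -> #|low_nbrs A t| = #|N :&: A|.
Proof.
move=> AW; apply: eq_card => u; rewrite !inE.
by case: (boolP (u \in A)) => //= [/(subsetP AW) -> |_]; rewrite ?andbT ?andbF.
Qed.

Let low_split A : A \subset W -> (#|low_nbrs A t| + #|low_nbrs (W :\: A) t|)%N = #|N|.
Proof.
move=> AW; rewrite -card_low_nbrsU ?disjoint_setD //.
by rewrite setDE setUIr setUCr setIT (setUidPr AW).
Qed.

(** The lower neighbours of t form a clique, which the independent set W - A meets at most once.
    Hence A contains all of them or all but one. *)
Let low_le1 A : indep (W :\: A) -> (#|low_nbrs (W :\: A) t| <= 1)%N.
Proof.
move=> ind; rewrite card_low ?subsetDl //.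
exact: card_clique_indep (top_clique_low_nbrs ltW) ind.
Qed.

Let low0 A : A \subset W -> (N \subset A) = (#|low_nbrs (W :\: A) t| == 0%N).
Proof.
move=> AW; rewrite card_low ?subsetDl // cards_eq0 setIDA.
rewrite (setIidPl _) ?setD_eq0 //.
by apply/subsetP => u; rewrite inE => /andP[].
Qed.

Let disjN A : A \subset W -> [disjoint N & W :\: A] = (N \subset A).
Proof. by move=> AW; rewrite low0 // card_low ?subsetDl // cards_eq0 setI_eq0. Qed.

(** If t is left out of A, it joins the independent set, which forces N into A and adds no
    inversion, since t is larger than every vertex of A. If t is in A, it brings one cycle factor
    and its inversions with W - A. *)
Lemma split_sum_top0 :
  split_sum (t |: W) set0 = x * split_sum W N
    + \sum_(A : {set 'I_n} | A \subset W) (if (b \in A) && indep (W :\: A) then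
       qnum #|low_nbrs A t| * q ^+ #|low_nbrs (W :\: A) t| *
       (cyc_weight b A * q ^+ back_inv A (W :\: A) * x ^+ #|W :\: A| * y ^+ #|A|.+1)
       else 0).
Proof.
rewrite /split_sum big_subset_setU1 ?(top_notin ltW) // big_split /= addrC.
congr (_ + _); rewrite ?big_distrr; apply: eq_bigr => A AW /=.
  rewrite setD_top_r // (indep_top ltW) ?subsetDl // disjN // sub0set andbT andbA.
  case: ifP => [/andP[/andP[bA ind] NA]|]; last by rewrite mulr0.
  rewrite (back_inv_topr ltW) ?subsetDl // cardsU1 (top_notin ltW) ?subsetDl //=.
  by rewrite add1n exprS; ring.
rewrite setD_top_l // sub0set !inE eq_sym tNb /= andbT; case: ifP => // /andP[bA ind].
rewrite (cyc_weight_top ltW) // (back_inv_topl ltW) // cardsU1 (top_notin ltW) //=.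
by rewrite add1n exprD; ring.
Qed.

(** Here leaving t out of A costs |N| inversions, as t is now written before all its lower
    neighbours. *)
Lemma split_sum'_top0 :
  split_sum' (t |: W) set0 = x * q ^+ #|N| * split_sum' W N
    + \sum_(A : {set 'I_n} | A \subset W) (if (b \in A) && indep (W :\: A) then
       qnum #|low_nbrs A t| *
       (cyc_weight b A * q ^+ back_inv (W :\: A) A * x ^+ #|W :\: A| * y ^+ #|A|.+1)
       else 0).
Proof.
rewrite /split_sum' big_subset_setU1 ?(top_notin ltW) // big_split /= addrC.
congr (_ + _); rewrite ?big_distrr; apply: eq_bigr => A AW /=.
  rewrite setD_top_r // (indep_top ltW) ?subsetDl // disjN // sub0set andbT andbA.
  case: ifP => [/andP[/andP[bA ind] NA]|]; last by rewrite mulr0.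
  rewrite (back_inv_topl ltW _ (subsetDl _ _)) cardsU1 (top_notin ltW) ?subsetDl //=.
  have -> : #|low_nbrs A t| = #|N|.
    by move: NA; rewrite low0 // -(low_split AW) => /eqP ->; rewrite addn0.
  by rewrite add1n exprS exprD; ring.
rewrite setD_top_l // sub0set !inE eq_sym tNb /= andbT; case: ifP => // /andP[bA ind].
rewrite (cyc_weight_top ltW) // (back_inv_topr ltW) ?subsetDl // cardsU1 (top_notin ltW) //=.
by rewrite add1n; ring.
Qed.

Lemma split_sum_topK K : t \in K ->
  split_sum (t |: W) K =
    \sum_(A : {set 'I_n} | A \subset W) (if [&& b \in A, indep (W :\: A) & K :\ t \subset A] then
       qnum #|low_nbrs A t| * q ^+ #|low_nbrs (W :\: A) t| *
       (cyc_weight b A * q ^+ back_inv A (W :\: A) * x ^+ #|W :\: A| * y ^+ #|A|.+1)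
       else 0).
Proof.
move=> tK; rewrite /split_sum big_subset_setU1 ?(top_notin ltW) //.
apply: eq_bigr => A AW /=; rewrite [X in _ + X]ifF ?addr0; last first.
  apply/negP => /and3P[_ _ /subsetP/(_ _ tK)]; apply/negP; exact: top_notin AW.
rewrite setD_top_l // !inE eq_sym tNb /= -subDset; case: ifP => // /and3P[bA ind _].
rewrite (cyc_weight_top ltW) // (back_inv_topl ltW) // cardsU1 (top_notin ltW) //=.
by rewrite add1n exprD; ring.
Qed.

Lemma split_sum'_topK K : t \in K ->
  split_sum' (t |: W) K =
    \sum_(A : {set 'I_n} | A \subset W) (if [&& b \in A, indep (W :\: A) & K :\ t \subset A] then
       qnum #|low_nbrs A t| *
       (cyc_weight b A * q ^+ back_inv (W :\: A) A * x ^+ #|W :\: A| * y ^+ #|A|.+1)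
       else 0).
Proof.
move=> tK; rewrite /split_sum' big_subset_setU1 ?(top_notin ltW) //.
apply: eq_bigr => A AW /=; rewrite [X in _ + X]ifF ?addr0; last first.
  apply/negP => /and3P[_ _ /subsetP/(_ _ tK)]; apply/negP; exact: top_notin AW.
rewrite setD_top_l // !inE eq_sym tNb /= -subDset; case: ifP => // /and3P[bA ind _].
rewrite (cyc_weight_top ltW) // (back_inv_topr ltW) ?subsetDl // cardsU1 (top_notin ltW) //=.
by rewrite add1n; ring.
Qed.

(** Either N is in A and t has weight [d+1]_q = 1 + q [d]_q, or exactly one lower neighbour is
    outside and the weight is q [d]_q. The common part is summed over all A containing K1, the extra
    1 over those containing N. *)
Lemma split_sum_top_aux K1 d : #|N| = d.+1 -> K1 \subset N ->
  \sum_(A : {set 'I_n} | A \subset W) (if [&& b \in A, indep (W :\: A) & K1 \subset A] then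
       qnum #|low_nbrs A t| * q ^+ #|low_nbrs (W :\: A) t| *
       (cyc_weight b A * q ^+ back_inv A (W :\: A) * x ^+ #|W :\: A| * y ^+ #|A|.+1)
       else 0)
  = y * (split_sum W N + q * qnum d * split_sum W K1).
Proof.
have [c cE] : {c | qnum d = c} by exists (qnum d).
move=> Nd KN; rewrite cE mulrDr /split_sum !big_distrr /= -big_split /=.
apply: eq_bigr => A AW; have [bA|] := boolP (b \in A); last by rewrite !mulr0 addr0.
have [ind|] := boolP (indep _); last by rewrite !mulr0 addr0.
have [K1A|K1A] /= := boolP (K1 \subset A); last first.
  rewrite ifF ?mulr0 ?addr0 //; apply: contraNF K1A.
  exact: subset_trans.
have := low_split AW; have := low_le1 ind; rewrite low0 // Nd.
case: #|low_nbrs (W :\: A) t| => [|[|]] //= _; [rewrite addn0 => -> | rewrite addn1 => -[->]].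
  by rewrite qnumSl cE (exprS y); ring.
by rewrite cE (exprS y); ring.
Qed.

(** The same two cases, with [d+1]_q = [d]_q + q^d; a neighbour outside A now costs no power of
    q. *)
Lemma split_sum'_top_aux K1 d : #|N| = d.+1 -> K1 \subset N ->
  \sum_(A : {set 'I_n} | A \subset W) (if [&& b \in A, indep (W :\: A) & K1 \subset A] then
       qnum #|low_nbrs A t| *
       (cyc_weight b A * q ^+ back_inv (W :\: A) A * x ^+ #|W :\: A| * y ^+ #|A|.+1)
       else 0)
  = y * (q ^+ d * split_sum' W N + qnum d * split_sum' W K1).
Proof.
have [c cE] : {c | qnum d = c} by exists (qnum d).
move=> Nd KN; rewrite cE mulrDr /split_sum' !big_distrr /= -big_split /=.
apply: eq_bigr => A AW; have [bA|] := boolP (b \in A); last by rewrite !mulr0 addr0.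
have [ind|] := boolP (indep _); last by rewrite !mulr0 addr0.
have [K1A|K1A] /= := boolP (K1 \subset A); last first.
  rewrite ifF ?mulr0 ?addr0 //; apply: contraNF K1A.
  exact: subset_trans.
have := low_split AW; have := low_le1 ind; rewrite low0 // Nd.
case: #|low_nbrs (W :\: A) t| => [|[|]] //= _; [rewrite addn0 => -> | rewrite addn1 => -[->]].
  by rewrite qnumS cE (exprS y); ring.
by rewrite cE (exprS y); ring.
Qed.

Lemma qnum_isolated A : #|N| = 0%N -> A \subset W -> qnum #|low_nbrs A t| = 0.
Proof.
move=> N0 AW; have := low_split AW; rewrite N0 => /eqP.
by rewrite addn_eq0 => /andP[/eqP -> _]; rewrite qnum0.
Qed.

End AddTopSum.

Definition indepR W : R := (indep W)%:R.

Lemma set_max_ind (P : {set 'I_n} -> Prop) :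
  P [set b] ->
  (forall W t, b \in W -> (forall u, u \in W -> (b <= u)%N) ->
     (forall u, u \in W -> (u < t)%N) -> P W -> P (t |: W)) ->
  forall W, b \in W -> (forall u, u \in W -> (b <= u)%N) -> P W.
Proof.
move=> P1 PS W; have [k] := ubnP #|W|; elim: k W => // k IH W Wk bW minb.
have [t tW tmax] : exists2 t, t \in W & forall u, u \in W -> (u <= t)%N.
  by case: (@arg_maxnP _ b (mem W) (fun u => u : nat) bW) => t tW tm; exists t.
have [tb|tb] := eqVneq t b.
  suff -> : W = [set b] by [].
  apply/setP => u; rewrite inE; apply/idP/eqP => [uW|-> //].
  apply: val_inj; apply/eqP; rewrite eqn_leq minb // andbT.
  by rewrite -tb; apply: tmax.
rewrite -(setD1K tW); apply: PS.
- by rewrite !inE eq_sym tb.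
- by move=> u; rewrite !inE => /andP[_ /minb].
- by move=> u; rewrite !inE ltn_neqAle => /andP[ut /tmax ->]; rewrite andbT.
- apply: IH; [|by rewrite !inE eq_sym tb|by move=> u; rewrite !inE => /andP[_ /minb]].
  by move: Wk; rewrite (cardsD1 t) tW.
Qed.

Lemma split_sum1 K : K \subset [set b] -> split_sum [set b] K = y.
Proof.
move=> Kb; rewrite /split_sum (bigD1 [set b]) //= set11 setDv Kb.
have -> : indep set0 by apply/indepP => u v; rewrite inE.
rewrite /= /cyc_weight setDv big_set0 back_inv0 cards0 cards1.
rewrite big1 => [|A /andP[Ab AN]]; first by rewrite !expr0 expr1 !mul1r addr0.
rewrite ifF //; apply: contraNF AN => /and3P[bA _ _].
by rewrite eqEsubset Ab sub1set.
Qed.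

Lemma split_sum'1 K : K \subset [set b] -> split_sum' [set b] K = y.
Proof.
move=> Kb; rewrite -(split_sum1 Kb) /split_sum' /split_sum.
rewrite (bigD1 [set b]) //= [in RHS](bigD1 [set b]) //= setDv.
rewrite back_inv0 back_inv0l; congr (_ + _).
rewrite !big1 // => A /andP[Ab AN]; rewrite ifF //; apply: contraNF AN => /and3P[bA _ _];
  by rewrite eqEsubset Ab sub1set.
Qed.

(* The third clause, where K is a clique of top vertices, is what makes the   *)
(* induction on the largest vertex work: it is applied to the set of lower    *)
(* neighbours of the vertex being added.                                      *)
Lemma split_sumE W : b \in W -> (forall u, u \in W -> (b <= u)%N) ->
  exists Theta : R,
  [/\ split_sum W set0 = indepR W * x ^+ #|W|.-1 * y + (x + y) * Theta,
      split_sum' W set0 = indepR W * x ^+ #|W|.-1 * y + (q * x + y) * Theta &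
      forall K, top_clique W K -> K != set0 ->
        split_sum W K + q ^+ #|K|.-1 * (y * Theta) =
        q ^+ #|K|.-1 * split_sum' W K + y * Theta].
Proof.
move: W; apply: set_max_ind => [|W t bW minb ltW [Th [IT IT' IK]]].
  (* For W = {b} both sums equal y, so Theta vanishes. *)
  exists 0; rewrite !mulr0 !addr0 split_sum1 ?sub0set // split_sum'1 ?sub0set //.
  rewrite /indepR indep1 cards1 expr0 !mul1r; split=> // K [Kb _ _] K0.
  rewrite split_sum1 // split_sum'1 // !mulr0 !addr0.
  have -> : #|K| = 1%N.
    apply/eqP; rewrite eqn_leq card_gt0 K0 andbT.
    by rewrite -(cards1 b) subset_leq_card.
  by rewrite expr0 mul1r.
have tW := top_notin ltW (subxx W).
set N := low_nbrs W t; have Ncl : top_clique W N := top_clique_low_nbrs ltW.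
have cW : #|t |: W|.-1 = #|W|.-1.+1.
  by rewrite cardsU1 tW /= add0n prednK // card_gt0; apply/set0Pn; exists b.
case dN : #|N| => [|d].
  have N0 : N = set0 by apply/eqP; rewrite -cards_eq0 dN.
  have Iind : indepR (t |: W) = indepR W.
    by rewrite /indepR (indep_top ltW) // -/N N0 disjoints_subset sub0set andbT.
  have iso A := qnum_isolated (A := A) dN.
  (* Without lower neighbours t cannot lie in A, its cycle factor being [0]_q = 0; it only
     multiplies both sums by x. *)
  exists (x * Th); rewrite Iind cW exprS; split.
  - rewrite split_sum_top0 // -/N N0 IT big1 => [|A AW]; first by ring.
    by rewrite iso // !mul0r if_same.
  - rewrite split_sum'_top0 // -/N N0 cards0 expr0 IT' big1 => [|A AW]; first by ring.
    by rewrite iso // !mul0r if_same.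
  - move=> K Kcl K0; have [tK K1cl K1N] := top_cliqueD1 ltW K0 Kcl.
    rewrite split_sum_topK // split_sum'_topK // !big1 => [|A AW|A AW]; first last.
    + by rewrite iso // !mul0r if_same.
    + by rewrite iso // !mul0r if_same.
    have -> : #|K|.-1 = 0%N.
      rewrite (cardsD1 t) tK /= add0n; apply/eqP; rewrite -leqn0 -dN.
      exact: subset_leq_card.
    by rewrite expr0; ring.
have N0 : N != set0 by rewrite -card_gt0 dN.
have INew : indepR (t |: W) = 0.
  rewrite /indepR (indep_top ltW) // -/N (_ : [disjoint _ & _] = false) ?andbF //.
  apply/negP; rewrite -setI_eq0 (setIidPl _) ?(negbTE N0) //.
  by case: Ncl.
(* If W is independent, the clique N has a single vertex, so d = 0. *)
have cI : qnum d * indepR W = 0.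
  rewrite /indepR; case: (boolP (indep W)) => [ind|_]; last by rewrite mulr0.
  have := card_clique_indep Ncl ind; rewrite (setIidPl _); last by case: Ncl.
  by rewrite dN ltnS leqn0 => /eqP ->; rewrite qnum0 mul0r.
have IN := IK N Ncl N0; rewrite dN /= in IN.
set PN := split_sum W N in IN *; set PN' := split_sum' W N in IN *.
set c := qnum d in cI *.
have qd := qnum_exp d; rewrite -/c in qd; rewrite qd in IN.
(* The third clause for N itself, with q^d = 1 + (q - 1) [d]_q; it eliminates PN' in favour of
   PN. *)
have PN'E : q ^+ d * PN' = PN + (q - 1) * c * y * Th.
  by rewrite qd; apply: (addIr (y * Th)); rewrite -IN; ring.
have Taux K1 := split_sum_top_aux ltW dN (K1 := K1).
have Taux' K1 := split_sum'_top_aux ltW dN (K1 := K1).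
(* Read off from the first recurrence: x PN + y (PN + q c (x + y) Th) is x + y times this witness,
   and [cI] kills the term with [indepR W]. *)
exists (PN + y * q * c * Th); split.
- rewrite INew !mul0r add0r split_sum_top0 //.
  have := Taux set0 (sub0set _); rewrite -/N -/PN -/c IT.
  under eq_bigr do rewrite sub0set andbT.
  move=> ->; transitivity ((x + y) * (PN + y * q * c * Th) + y * q * x ^+ #|W|.-1 * y * (c * indepR W)).
    by ring.
  by rewrite cI mulr0 addr0.
- rewrite INew !mul0r add0r split_sum'_top0 // -/N dN.
  have := Taux' set0 (sub0set _); rewrite -/N -/PN' -/c IT'.
  under eq_bigr do rewrite sub0set andbT.
  move=> ->; rewrite PN'E.
  have -> : x * q ^+ d.+1 * PN' = x * q * (PN + (q - 1) * c * y * Th).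
    by rewrite -PN'E exprS; ring.
  transitivity ((q * x + y) * (PN + y * q * c * Th) + y * x ^+ #|W|.-1 * y * (c * indepR W)).
    by ring.
  by rewrite cI mulr0 addr0.
- move=> K Kcl K0; have [tK K1cl K1N] := top_cliqueD1 ltW K0 Kcl.
  rewrite split_sum_topK // split_sum'_topK // Taux // Taux' // -/N -/PN -/PN' -/c PN'E.
  have -> : #|K|.-1 = #|K :\ t| by rewrite (cardsD1 t) tK.
  (* If K = {t}, the first two clauses for W are used; otherwise the third one, for K :\ t. *)
  have [K10|K10] := eqVneq (K :\ t) set0.
    rewrite K10 cards0 expr0 IT IT' !mul1r.
    transitivity (y * (PN + (q - 1) * c * y * Th + c * ((q * x + y) * Th)) +
      y * (PN + y * q * c * Th) + y * q * x ^+ #|W|.-1 * y * (c * indepR W)).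
      by ring.
    rewrite cI mulr0 addr0; symmetry.
    transitivity (y * (PN + (q - 1) * c * y * Th + c * ((q * x + y) * Th)) +
      y * (PN + y * q * c * Th) + y * x ^+ #|W|.-1 * y * (c * indepR W)).
      by ring.
    by rewrite cI mulr0 addr0.
  have := IK _ K1cl K10.
  have -> : #|K :\ t| = #|K :\ t|.-1.+1 by rewrite prednK // card_gt0.
  set P1 := split_sum W _; set P1' := split_sum' W _; set Q1 := q ^+ _ => e.
  rewrite exprS /= -/Q1.
  have P1E : Q1 * P1' = P1 + Q1 * y * Th - y * Th.
    by apply: (addIr (y * Th)); rewrite -e; ring.
  have -> : q * Q1 * (y * (PN + (q - 1) * c * y * Th + c * P1')) =
    q * y * (Q1 * (PN + (q - 1) * c * y * Th) + c * (Q1 * P1')) by ring.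
  by rewrite P1E; ring.
Qed.

End CycleWeight.

End Indifference.

(** * The coefficients of E(qz) / E(z) *)

Section QuotientCoef.
Variables (R : comNzRingType) (q : R) (x : nat -> R).

(* The coefficient of z^k in E(qz) / E(z), with E the generating function of *)
(* the elementary symmetric polynomials in x_0, ..., x_(j-1).                *)
Fixpoint quot_coef j : nat -> R :=
  if j is i.+1 then
    fix c k := if k is l.+1 then
      quot_coef i k + q * x i * quot_coef i l - x i * c l else 1
  else fun k => (k == 0%N)%:R.

Lemma quot_coef0 j : quot_coef j 0 = 1.
Proof. by case: j. Qed.

Lemma quot_coef_nil k : quot_coef 0 k = (k == 0%N)%:R.
Proof. by []. Qed.

(** Comparison of coefficients in (1 + x_j z) Q_{j+1}(z) = (1 + q x_j z) Q_j(z), where Q_j is the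
    quotient for j variables. *)
Lemma quot_coefS j k :
  quot_coef j.+1 k.+1 + x j * quot_coef j.+1 k =
  quot_coef j k.+1 + q * x j * quot_coef j k.
Proof. by rewrite [LHS]/= subrK. Qed.

(** The linear functional that sends the k-th power of the variable to [quot_coef j k]; it carries
    polynomial identities in y over to quotient coefficients. *)
Definition quot_eval j (p : {poly R}) : R := \sum_(i < size p) p`_i * quot_coef j i.

Lemma quot_eval_wide j (p : {poly R}) d : (size p <= d)%N ->
  quot_eval j p = \sum_(i < d) p`_i * quot_coef j i.
Proof.
move=> pd; rewrite /quot_eval.
rewrite (big_ord_widen d (fun i => p`_i * quot_coef j i) pd) big_mkcond /=.
by apply: eq_bigr => i _; case: ltnP => // ?; rewrite nth_default ?mul0r.
Qed.

Lemma quot_eval_is_linear j : linear_for *%R (quot_eval j).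
Proof.
move=> c p r; set d := maxn (size (c *: p + r)) (maxn (size p) (size r)).
rewrite !(@quot_eval_wide j _ d) ?leq_max ?leqnn ?orbT //.
rewrite big_distrr -big_split /=; apply: eq_bigr => i _.
by rewrite coefD coefZ mulrDl mulrA.
Qed.
HB.instance Definition _ j :=
  GRing.isLinear.Build R {poly R} R _ (quot_eval j) (quot_eval_is_linear j).

Lemma quot_evalXn j k : quot_eval j 'X^k = quot_coef j k.
Proof.
rewrite /quot_eval size_polyXn big_ord_recr /= coefXn eqxx mul1r big1 ?add0r //.
by move=> i _; rewrite coefXn ltn_eqF ?mul0r.
Qed.

(** This is [quot_coefS] on each power. It makes the terms (x + y) Theta and (q x + y) Theta of
    [split_sumE] agree, the first evaluated with j + 1 variables and the second with j. *)
Lemma quot_evalS j p :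
  quot_eval j.+1 (((x j)%:P + 'X) * p) = quot_eval j ((q%:P * (x j)%:P + 'X) * p).
Proof.
rewrite -[p]coefK poly_def !mulr_sumr !linear_sum; apply: eq_bigr => i _.
rewrite -!scalerAr !mulrDl -exprS -polyCM !mul_polyC !linearD !linearZ /=.
by rewrite !quot_evalXn -!mulrDr addrC quot_coefS addrC.
Qed.

End QuotientCoef.

(** * Evaluating the splitting identity *)

Section SplitEval.
Variables (n : nat) (m : 'I_n -> 'I_n).
Hypothesis hm : hessenberg m.
Variables (R : comNzRingType) (q : R) (x : nat -> R) (b : 'I_n).
Local Notation cw := (cyc_weight m q b).
Local Notation inv := (back_inv m).

Lemma cyc_weightC A : cyc_weight m q%:P b A = (cw A)%:P.
Proof.
rewrite /cyc_weight rmorph_prod; apply: eq_bigr => v _.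
by rewrite /qnum rmorph_sum; apply: eq_bigr => i _; rewrite rmorphXn.
Qed.

(** [split_sumE] is taken with y the polynomial variable and evaluated by [quot_eval]. The Theta
    terms cancel; for independent W there remains x_j^(|W|-1) times the difference (q - 1) x_j of
    the coefficients of degree 1. *)
Lemma split_sum_quotS j (W : {set 'I_n}) : b \in W ->
  (forall u, u \in W -> (b <= u)%N) ->
  \sum_(A : {set 'I_n} | A \subset W) (if (b \in A) && indep m (W :\: A) then
    cw A * q ^+ inv A (W :\: A) * x j ^+ #|W :\: A| * quot_coef q x j.+1 #|A| else 0)
  = \sum_(A : {set 'I_n} | A \subset W) (if (b \in A) && indep m (W :\: A) then
    cw A * q ^+ inv (W :\: A) A * x j ^+ #|W :\: A| * quot_coef q x j #|A| else 0)
  + (q - 1) * (if indep m W then x j ^+ #|W| else 0).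
Proof.
move=> bW minb.
have [Th [T T' _]] := split_sumE hm q%:P (x j)%:P 'X bW minb.
pose c A i := cw A * q ^+ i * x j ^+ #|W :\: A|.
have TE : \sum_(A : {set 'I_n} | A \subset W) (if (b \in A) && indep m (W :\: A) then
    c A (inv A (W :\: A)) * quot_coef q x j.+1 #|A| else 0)
    = quot_eval q x j.+1 (split_sum m q%:P b (x j)%:P 'X W set0).
  rewrite /split_sum linear_sum; apply: eq_bigr => A _.
  rewrite sub0set andbT; case: ifP => _; last by rewrite linear0.
  by rewrite cyc_weightC -!rmorphXn -!polyCM mul_polyC linearZ /= quot_evalXn.
have TE' : \sum_(A : {set 'I_n} | A \subset W) (if (b \in A) && indep m (W :\: A) then
    c A (inv (W :\: A) A) * quot_coef q x j #|A| else 0)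
    = quot_eval q x j (split_sum' m q%:P b (x j)%:P 'X W set0).
  rewrite /split_sum' linear_sum; apply: eq_bigr => A _.
  rewrite sub0set andbT; case: ifP => _; last by rewrite linear0.
  by rewrite cyc_weightC -!rmorphXn -!polyCM mul_polyC linearZ /= quot_evalXn.
rewrite TE TE' T T' !linearD /= quot_evalS -!addrA [RHS]addrCA addrC; congr (_ + _).
rewrite /indepR; case: ifP => _; last by rewrite !mul0r !linear0 mulr0 addr0.
rewrite !mul1r -rmorphXn mul_polyC !linearZ /= -['X]expr1 !quot_evalXn.
have -> : x j ^+ #|W| = x j ^+ #|W|.-1 * x j.
  by rewrite -exprSr prednK // card_gt0; apply/set0Pn; exists b.
have -> : quot_coef q x j.+1 1 = quot_coef q x j 1 + q * x j - x j.
  by rewrite /= quot_coef0 mulr1 mulr1.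
ring.
Qed.

End SplitEval.

Arguments quot_coef : simpl never.

(** * Colourings *)

Section Colorings.
Variables (n : nat) (m : 'I_n -> 'I_n).
Hypothesis hm : hessenberg m.
Variables (R : comNzRingType) (q : R) (x : nat -> R) (N : nat).
Implicit Types (B S : {set 'I_n}) (k : {ffun 'I_n -> 'I_N.+1}).
Local Notation inv := (back_inv m).

(* A colouring of B with colours < j, extended by the dummy colour 0 outside B. *)
Definition colors_on j B k :=
  [forall v, if v \in B then (k v < j)%N else k v == ord0] &&
  [forall u in B, forall v in B, edge_up m u v ==> (k u != k v)].

Definition asc_on B k : nat :=
  \sum_(v in B) #|[set u in low_nbrs m B v | (k u < k v)%N]|.

Definition csf_on j B : R :=
  \sum_(k | colors_on j B k) q ^+ asc_on B k * \prod_(v in B) x (k v).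

Lemma colors_onP j B k :
  reflect [/\ (forall v, v \in B -> (k v < j)%N), (forall v, v \notin B -> k v = ord0)
            & {in B &, forall u v, edge_up m u v -> k u != k v}] (colors_on j B k).
Proof.
apply: (iffP andP) => [[/forallP h /forall_inP p]|[h1 h2 h3]].
  split=> [v vB|v vB|u v uB vB uv].
  - by have := h v; rewrite vB.
  - by have := h v; rewrite (negbTE vB) => /eqP.
  - by have /forall_inP/(_ v vB)/implyP := p u uB; apply.
split; first by apply/forallP => v; case: ifPn => [/h1//|/h2/eqP].
apply/forall_inP => u uB; apply/forall_inP => v vB; apply/implyP; exact: h3.
Qed.

Lemma csf_on_set0 j : csf_on j set0 = 1.
Proof.
rewrite /csf_on (big_pred1 [ffun=> ord0]) => [|k].
  by rewrite /asc_on !big_set0 expr0 mulr1.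
apply/colors_onP/eqP => [[_ h _]|->]; last first.
  by split=> [v|v _|u v]; rewrite ?inE // ffunE.
by apply/ffunP => v; rewrite ffunE h // inE.
Qed.

Lemma csf_on0 B : B != set0 -> csf_on 0 B = 0.
Proof.
case/set0Pn=> v vB; rewrite /csf_on big_pred0 // => k.
by apply/negP => /colors_onP[/(_ v vB)].
Qed.

(** S is the class of the largest colour j. An edge between S and B - S is an ascent exactly when
    its upper end is in S, which accounts for inv(S, B - S). *)
Lemma csf_onS j B : (j <= N)%N ->
  csf_on j.+1 B = \sum_(S : {set 'I_n} | S \subset B)
    (if indep m S then x j ^+ #|S| * q ^+ inv S (B :\: S) * csf_on j (B :\: S) else 0).
Proof.
move=> jN; pose c : 'I_N.+1 := Ordinal (jN : (j < N.+1)%N).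
rewrite /csf_on (partition_big (fun k => [set v in B | k v == c])
   (fun S => (S \subset B) && indep m S)) /=; last first.
  move=> k /colors_onP[_ _ kp]; apply/andP; split.
    by apply/subsetP => v; rewrite inE => /andP[].
  apply/indepP => u v; rewrite !inE => /andP[uB /eqP uc] /andP[vB /eqP vc].
  by apply/negP => /(kp u v uB vB); rewrite uc vc eqxx.
rewrite big_mkcondr /=; apply: eq_bigr => S SB; case: ifP => // /indepP ind.
(* Colourings of B with top class S correspond to colourings of B - S: the vertices of S switch
   between the colour j and the dummy colour. *)
rewrite (reindex_onto (fun k => [ffun v => if v \in S then c else k v])
                      (fun k => [ffun v => if v \in S then ord0 else k v])) /=; last first.
  move=> k /andP[_ /eqP Sk]; apply/ffunP => v; rewrite !ffunE.
  by case: (boolP (v \in S)) => // vS; move: (vS); rewrite -Sk inE => /andP[_ /eqP ->].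
have col k : (colors_on j.+1 B [ffun v => if v \in S then c else k v] &&
   ([set v in B | [ffun v => if v \in S then c else k v] v == c] == S)) &&
   ([ffun v => if v \in S then ord0 else [ffun v => if v \in S then c else k v] v] == k)
   = colors_on j (B :\: S) k.
  apply/idP/colors_onP => [/andP[/andP[/colors_onP[h1 h2 h3] /eqP/setP Sk] /eqP/ffunP kk]|[h1 h2 h3]].
    split=> [v|v|u v].
    - rewrite !inE => /andP[vS vB]; have := h1 v vB; rewrite ffunE (negbTE vS) ltnS.
      rewrite leq_eqVlt => /predU1P[e|//]; have := Sk v.
      by rewrite !inE vB ffunE (negbTE vS) -val_eqE /= e eqxx.
    - rewrite !inE negb_and negbK => /orP[vS|vB]; first by rewrite -kk !ffunE vS.
      have vS : v \notin S by apply: contra vB; apply/subsetP.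
      by have := h2 v vB; rewrite ffunE (negbTE vS).
    - rewrite !inE => /andP[uS uB] /andP[vS vB] /(h3 u v uB vB).
      by rewrite !ffunE (negbTE uS) (negbTE vS).
  have h1' v : v \in B -> v \notin S -> (k v < j)%N by move=> vB vS; apply: h1; rewrite !inE vS.
  apply/andP; split; [apply/andP; split|].
  - apply/colors_onP; split=> [v vB|v vB|u v uB vB uv]; rewrite !ffunE.
    + by case: (boolP (v \in S)) => [_ //=|/(h1' v vB)/ltnW].
    + have vS : v \notin S by apply: contra vB; apply/subsetP.
      by rewrite (negbTE vS) h2 // !inE (negbTE vB) andbF.
    + case: (boolP (u \in S)) => uS; case: (boolP (v \in S)) => vS.
      * by rewrite (negbTE (ind u v uS vS)) in uv.
      * by rewrite -val_eqE /= gtn_eqF // h1'.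
      * by rewrite -val_eqE /= ltn_eqF // h1'.
      * by apply: h3; rewrite ?inE ?uS ?vS.
  - apply/eqP/setP => v; rewrite !inE ffunE; case: (boolP (v \in S)) => vS.
      by rewrite eqxx (subsetP SB).
    by case: (boolP (v \in B)) => //= vB; rewrite -val_eqE /= ltn_eqF // h1'.
  - apply/eqP/ffunP => v; rewrite !ffunE; case: (boolP (v \in S)) => // vS.
    by rewrite h2 // !inE vS.
rewrite (eq_bigl _ _ col) big_distrr /=; apply: eq_bigr => k /colors_onP[h1 h2 _].
have h1' v : v \in B -> v \notin S -> (k v < j)%N by move=> vB vS; apply: h1; rewrite !inE vS.
rewrite (big_setID S) /= (setIidPr SB).
have -> : \prod_(v in S) x ([ffun v => if v \in S then c else k v] v) = x j ^+ #|S|.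
  by rewrite -prodr_const; apply: eq_bigr => v vS; rewrite ffunE vS.
have -> : \prod_(v in B :\: S) x ([ffun v => if v \in S then c else k v] v) =
          \prod_(v in B :\: S) x (k v).
  by apply: eq_bigr => v; rewrite inE ffunE => /andP[/negbTE -> _].
suff -> : asc_on B [ffun v => if v \in S then c else k v] =
    (inv S (B :\: S) + asc_on (B :\: S) k)%N by rewrite exprD; ring.
rewrite /asc_on (big_setID S) /= (setIidPr SB); congr addn; apply: eq_bigr => v.
  move=> vS; apply: eq_card => u; rewrite !inE !ffunE vS.
  case: (boolP (u \in B)) => uB; rewrite ?andbF //=; case: (boolP (u \in S)) => uS /=.
    by rewrite ltnn andbF.
  by rewrite (h1' u) ?andbT.
rewrite inE => /andP[vS vB]; apply: eq_card => u; rewrite !inE !ffunE (negbTE vS).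
case: (boolP (u \in B)) => uB; rewrite ?andbF //=; case: (boolP (u \in S)) => uS //=.
by rewrite ltnNge ltnW ?andbF // h1'.
Qed.

(** Induction on the number j of colours. The top class S of B - A is split off, and for fixed W = A
    :|: S the identity [split_sum_quotS] exchanges the blocks A and S while lowering j + 1 to j in
    the coefficient. *)
Lemma csf_on_cycle j B b : (j <= N.+1)%N -> b \in B -> (forall u, u \in B -> (b <= u)%N) ->
  (q - 1) * csf_on j B = \sum_(A : {set 'I_n} | A \subset B)
    (if b \in A then cyc_weight m q b A * q ^+ inv A (B :\: A) * quot_coef q x j #|A| *
       csf_on j (B :\: A) else 0).
Proof.
elim: j B => [|j IH] B jN bB minb.
  rewrite csf_on0 ?mulr0; last by apply/set0Pn; exists b.
  rewrite big1 // => A AB; case: ifP => // bA.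
  have /negbTE A0 : #|A| != 0%N by rewrite cards_eq0; apply/set0Pn; exists b.
  by rewrite quot_coef_nil A0 mulr0 mul0r.
have {}IH := IH _ (ltnW jN); rewrite ltnS in jN; symmetry.
pose f (A S : {set 'I_n}) := if (b \in A) && indep m S then
    cyc_weight m q b A * q ^+ inv A (B :\: A) * quot_coef q x j.+1 #|A| *
    (x j ^+ #|S| * q ^+ inv S (B :\: A :\: S) * csf_on j (B :\: A :\: S)) else 0.
transitivity (\sum_(A : {set 'I_n} | A \subset B)
    \sum_(S : {set 'I_n} | S \subset B :\: A) f A S).
  apply: eq_bigr => A AB; rewrite /f; case: ifP => bA; last by rewrite big1.
  rewrite csf_onS // big_distrr /=; apply: eq_bigr => S _.
  by case: ifP => // _; rewrite mulr0.
rewrite big_subset_nest.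
pose cW W := q ^+ inv W (B :\: W) * csf_on j (B :\: W).
pose g (W A : {set 'I_n}) := if (b \in A) && indep m (W :\: A) then
    cyc_weight m q b A * q ^+ inv (W :\: A) A * x j ^+ #|W :\: A| * quot_coef q x j #|A| else 0.
(* [cW W] collects what depends on W only. The inner sum passes from inv(A, W - A) to inv(W - A, A),
   with an extra term when W is independent. *)
transitivity (\sum_(W : {set 'I_n} | W \subset B)
   (cW W * \sum_(A : {set 'I_n} | A \subset W) g W A +
    if (b \in W) && indep m W then (q - 1) * (x j ^+ #|W| * cW W) else 0)).
  apply: eq_bigr => W WB; have [bW|bW] := boolP (b \in W); last first.
    have bA (A : {set 'I_n}) : A \subset W -> b \in A = false.
      by move=> AW; apply: contraNF bW; apply/subsetP.
    rewrite addr0 !big1 ?mulr0 // => A AW; first by rewrite /g bA.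
    by rewrite /f bA.
  have minW u : u \in W -> (b <= u)%N by move=> /(subsetP WB)/minb.
  transitivity (cW W * (\sum_(A : {set 'I_n} | A \subset W) g W A
       + (q - 1) * (if indep m W then x j ^+ #|W| else 0))); last first.
    by rewrite mulrDr /=; congr (_ + _); case: ifP => _; ring.
  rewrite /g -(split_sum_quotS hm q x j bW minW) big_distrr /=; apply: eq_bigr => A AW.
  rewrite /f; case: ifP => _; last by rewrite mulr0.
  rewrite setD_nest // (setD_split AW WB) back_invUr; last first.
    by rewrite disjoint_sym (disjointWr (subsetDl W A)) // disjoint_sym disjoint_setD.
  rewrite /cW.
  have -> : inv W (B :\: W) = (inv A (B :\: W) + inv (W :\: A) (B :\: W))%N.
    by rewrite -back_invUl ?disjoint_setD // setU_setD.
  by rewrite !exprD; ring.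
rewrite big_split /=.
(* Now S is chosen before A: it omits b, and the induction hypothesis applies to B - S. *)
have -> : \sum_(W : {set 'I_n} | W \subset B) cW W * (\sum_(A : {set 'I_n} | A \subset W) g W A)
  = \sum_(S : {set 'I_n} | S \subset B) (if (b \notin S) && indep m S then
      (q - 1) * (x j ^+ #|S| * q ^+ inv S (B :\: S) * csf_on j (B :\: S)) else 0).
  pose h (A S : {set 'I_n}) := if (b \in A) && indep m S then
     cW (A :|: S) * (cyc_weight m q b A * q ^+ inv S A * x j ^+ #|S| * quot_coef q x j #|A|)
     else 0.
  transitivity (\sum_(W : {set 'I_n} | W \subset B) \sum_(A : {set 'I_n} | A \subset W) h A (W :\: A)).
    apply: eq_bigr => W WB; rewrite big_distrr /=; apply: eq_bigr => A AW.
    rewrite /h /g; case: ifP => _; last by rewrite mulr0.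
    by rewrite setU_setD.
  rewrite -big_subset_nest exchange_subset; apply: eq_bigr => S SB.
  have [bS|bS] /= := boolP (b \in S).
    apply: big1 => A; rewrite subsetD => /andP[_ d]; rewrite /h.
    by rewrite (disjointFl d bS).
  have [ind|ind] /= := boolP (indep m S); last first.
    by rewrite big1 // => A _; rewrite /h (negbTE ind) andbF.
  rewrite mulrCA IH; first last.
  - by move=> u; rewrite inE => /andP[_ /minb].
  - by rewrite inE bS.
  rewrite big_distrr /=; apply: eq_bigr => A; rewrite subsetD => /andP[AB d].
  rewrite /h ind andbT; case: ifP => _; last by rewrite mulr0.
  have e1 : B :\: (A :|: S) = B :\: S :\: A by rewrite setUC setDDl.
  have e2 : B :\: S = A :|: (B :\: S :\: A).
    by rewrite setU_setD // subsetD AB.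
  rewrite /cW e1 back_invUl //.
  have -> : inv S (B :\: S) = (inv S A + inv S (B :\: S :\: A))%N.
    by rewrite {1}e2 back_invUr // disjoint_setD.
  by rewrite !exprD; ring.
(* The S containing b come from the extra term, those without b from the induction; together they
   give [csf_onS]. *)
rewrite -big_split /= csf_onS // big_distrr /=; apply: eq_bigr => S SB.
rewrite /cW; case: (b \in S) => /=; case: ifP => _; rewrite ?add0r ?addr0 ?mulr0 //; ring.
Qed.

End Colorings.

(** * Words and permutations *)

Definition insert_at (T : Type) (t : T) (w : seq T) i := take i w ++ t :: drop i w.

Lemma perm_insert_at (T : eqType) (t : T) w i : perm_eq (insert_at t w i) (t :: w).
Proof. by rewrite /insert_at perm_catC /= perm_cons perm_catC cat_take_drop. Qed.

(** A permutation v of t :: l determines the pair (w, i): deleting t from v gives w, and i is the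
    index of t in v. *)
Lemma permutations_insert (T : eqType) (t : T) (l : seq T) : uniq (t :: l) ->
  perm_eq (permutations (t :: l))
    [seq insert_at t w i | w <- permutations l, i <- iota 0 (size l).+1].
Proof.
move=> /andP[tl Ul].
have wP w : w \in permutations l -> (t \notin w) /\ size w = size l.
  by rewrite mem_permutations => wl; rewrite (perm_mem wl) (perm_size wl).
have rem_cat w1 w2 : t \notin w1 -> rem t (w1 ++ t :: w2) = w1 ++ w2.
  elim: w1 => [|u w1 IH] /=; first by rewrite eqxx.
  by rewrite inE negb_or eq_sym => /andP[/negbTE -> /IH ->].
have rem_ins w i : t \notin w -> rem t (insert_at t w i) = w.
  move=> tw; rewrite rem_cat ?cat_take_drop //.
  by apply: contra tw; apply: mem_take.
have idx_ins w i : t \notin w -> (i <= size w)%N -> index t (insert_at t w i) = i.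
  move=> tw iw; rewrite /insert_at index_cat ifN; last first.
    by apply: contra tw; apply: mem_take.
  by rewrite /= eqxx addn0 size_takel.
apply: uniq_perm; first exact: permutations_uniq.
  apply: allpairs_uniq; [exact: permutations_uniq|exact: iota_uniq|].
  move=> p1 p2 /allpairsP h1 /allpairsP h2.
  case: h1 => -[w i] [wl il ->]; case: h2 => -[w' i'] [wl' il' ->] e.
  have [tw sw] := wP w wl; have [tw' sw'] := wP w' wl'.
  move: il il'; rewrite !mem_iota !add0n !ltnS /= => il il'; rewrite /= in e.
  congr (_, _); first by rewrite -(rem_ins w i tw) e rem_ins.
  by rewrite -(idx_ins w i tw) ?sw // e idx_ins // sw'.
move=> v; rewrite mem_permutations; apply/idP/allpairsP => [vl|[[w i] [wl il ->]]]; last first.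
  by apply: perm_trans (perm_insert_at _ _ _) _; rewrite perm_cons -mem_permutations.
have tv : t \in v by rewrite (perm_mem vl) mem_head.
have rv : perm_eq (rem t v) l.
  by rewrite -(perm_cons t) -(permPl (perm_to_rem tv)).
exists (rem t v, index t v); split; first by rewrite mem_permutations.
  rewrite mem_iota add0n ltnS /= -(perm_size rv) size_rem // -ltnS prednK ?index_mem //.
  by case: (v) tv.
rewrite /= /insert_at remE take_size_cat ?size_takel ?index_size //.
rewrite drop_size_cat; last by rewrite size_takel // index_size.
by rewrite -[LHS](cat_take_drop (index t v)) (drop_nth t) ?index_mem // nth_index.
Qed.

Lemma count_uniq_set (T : finType) (p : pred T) (s : seq T) (A : {set T}) :
  uniq s -> s =i A -> count p s = #|[set u in A | p u]|.
Proof.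
move=> Us sA; rewrite -size_filter -(card_uniqP (filter_uniq p Us)).
by apply: eq_card => u; rewrite !inE mem_filter sA andbC.
Qed.

Section Words.
Variables (n : nat) (m : 'I_n -> 'I_n).
Hypothesis hm : hessenberg m.
Implicit Types (A B W : {set 'I_n}) (w : seq 'I_n) (u v t b : 'I_n).

Fixpoint word_inv w : nat :=
  if w is v :: w' then (count (fun u => edge_up m u v) w' + word_inv w')%N else 0%N.

Lemma ginv_word_inv w : ginv (indiff m) w = word_inv w.
Proof.
have gE u v : (v < u)%N && indiff m u v = edge_up m v u.
  rewrite indiffE; case: ltnP => [vu|uv] /=; first by rewrite (edge_upF m (ltnW vu)).
  by rewrite edge_upF.
have [d|no] := pickP (mem w); last first.
  case: w no => [_|v w /(_ v)]; last by rewrite /= mem_head.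
  by rewrite /ginv /=; apply: eq_card0 => -[[]].
move=> _; have -> : ginv (indiff m) w = (\sum_(i < size w) \sum_(j < size w)
    ((i < j)%N && edge_up m (nth d w j) (nth d w i)))%N.
  rewrite pair_bigA /ginv -sum1dep_card big_mkcond /=; apply: eq_bigr => -[i j] _ /=.
  by rewrite gE !(tnth_nth d) /=; case: (_ && _).
elim: w => [|v w IH] /=; first by rewrite big_ord0.
rewrite big_ord_recl /= big_ord_recl /= add0n; congr addn.
  by rewrite -sum1_count [RHS]big_mkcond (big_nth d) big_mkord; apply: eq_bigr => i _ /=; case: edge_up.
rewrite -IH; apply: eq_bigr => i _; rewrite big_ord_recl /= add0n.
by apply: eq_bigr => j _; rewrite /bump /= !add1n ltnS.
Qed.

Lemma word_inv_cat A B w1 w2 : uniq w1 -> uniq w2 -> w1 =i A -> w2 =i B ->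
  word_inv (w1 ++ w2) = (word_inv w1 + word_inv w2 + back_inv m A B)%N.
Proof.
move=> U1 U2 w1A w2B.
have -> : back_inv m A B = (\sum_(v <- w1) #|low_nbrs m B v|)%N.
  by rewrite /back_inv -(eq_bigl _ _ w1A) /= -big_uniq.
elim: w1 {U1 w1A} => [|v w IH] /=; first by rewrite big_nil addn0.
rewrite big_cons.
have -> : #|low_nbrs m B v| = count (fun u => edge_up m u v) w2.
  by rewrite (count_uniq_set _ U2 w2B).
by rewrite count_cat IH -!addnA; congr addn; rewrite addnCA; congr addn; rewrite addnCA.
Qed.

Lemma word_inv_insert t w1 w2 : all (fun u => (u < t)%N) w1 ->
  word_inv (w1 ++ t :: w2) =
  (word_inv (w1 ++ w2) + count (fun u => edge_up m u t) w2)%N.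
Proof.
elim: w1 => [|v w1 IH] /= => [_|/andP[vt wt]]; first by rewrite addnC.
by rewrite !count_cat /= (edge_upF m (ltnW vt)) IH // add0n addnA.
Qed.

Local Notation next_ok := [rel u v : 'I_n | (v <= m u)%N].

(** When t is inserted between a and d, the step from a to t needs an edge; the step from t to d
    holds since d < t <= m t, and the old step from a to d follows from d < t <= m a. *)
Lemma path_insert b t w i : all (fun u => (u < t)%N) (b :: w) ->
  path next_ok b (insert_at t w i) =
  path next_ok b w && edge_up m (last b (take i w)) t.
Proof.
move=> /= /andP[bt wt]; rewrite /insert_at -{3}[w](cat_take_drop i) !cat_path /=.
have lt : (last b (take i w) < t)%N.
  have : all (fun u : 'I_n => (u < t)%N) (b :: take i w).
    by rewrite /= bt; apply/allP => u /mem_take /(allP wt).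
  by move/allP; apply; apply: mem_last.
rewrite /edge_up /= lt /= -andbA; congr (_ && _).
have dt : all (fun u : 'I_n => (u < t)%N) (drop i w).
  by apply/allP => u /mem_drop /(allP wt).
case: (drop i w) dt => [|d w'] /=; first by rewrite andbT.
move=> /andP[dt _]; have [_ mge] := hm.
have [tl|] /= := leqP t (m (last b (take i w))); last by rewrite andbF.
by rewrite andbT (leq_trans (ltnW dt) (mge t)) (leq_trans (ltnW dt) tl).
Qed.

Variables (R : comNzRingType) (q : R).

(** The admissible positions are those right after a letter satisfying p, and the exponent is the
    number of such letters that follow, so each of 0, ..., count - 1 occurs once. *)
Lemma sum_insert_positions (p : pred 'I_n) b w :
  \sum_(i <- iota 0 (size w).+1 | p (last b (take i w))) q ^+ count p (drop i w)
  = qnum q (count p (b :: w)).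
Proof.
elim: w b => [|c w IH] b.
  rewrite [iota _ _]/= big_cons big_nil /= addn0.
  by case: (p b); rewrite /qnum ?big_ord0 // big_ord1 addr0.
rewrite -[iota _ _]/(0%N :: iota 1 (size w).+1) (iotaDl 1) big_cons big_map /=.
have := IH c; rewrite /= => ->; case: (p b); rewrite ?add0n // add1n qnumS.
by rewrite addrC.
Qed.

(** Inserting the largest vertex t multiplies the sum by [d_t]_q. The path condition omits the
    closing step to b, which holds because b is least. *)
Lemma sum_words W b : b \in W -> (forall u, u \in W -> (b <= u)%N) ->
  \sum_(w <- permutations (enum (W :\ b)) | path next_ok b w) q ^+ word_inv (b :: w)
  = cyc_weight m q b W.
Proof.
move: W; apply: set_max_ind => [|W t bW minb ltW IH].
  rewrite /cyc_weight setDv enum_set0 big_set0.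
  have -> : permutations [::] = [:: [::]] :> seq (seq 'I_n) by [].
  by rewrite big_cons big_nil addr0.
have tb : t != b by apply: contraTneq (ltW b bW) => ->; rewrite ltnn.
have tW := top_notin ltW (subxx W).
set l := enum (W :\ b).
have lt : perm_eq (enum ((t |: W) :\ b)) (t :: l).
  apply: uniq_perm; rewrite ?enum_uniq //=.
    by rewrite mem_enum !inE (negbTE tW) andbF enum_uniq.
  by move=> u; rewrite inE !mem_enum !inE; case: (eqVneq u t) => [->|//]; rewrite tb.
have Utl : uniq (t :: l) by rewrite -(perm_uniq lt) enum_uniq.
rewrite (perm_big _ (perm_permutations lt)) (perm_big _ (permutations_insert Utl)).
rewrite (cyc_weight_top _ _ ltW (subxx W)) // -IH big_mkcond.
rewrite big_allpairs_dep big_distrr [RHS]big_mkcond.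
apply: eq_big_seq => w; rewrite mem_permutations => wl.
have wW u : (u \in b :: w) = (u \in W).
  by rewrite inE (perm_mem wl) mem_enum !inE; case: eqP => //= ->; rewrite bW.
have wt : all (fun u => (u < t)%N) (b :: w) by apply/allP => u; rewrite wW => /ltW.
have Ubw : uniq (b :: w).
  rewrite /= (perm_uniq wl) enum_uniq andbT.
  by rewrite (perm_mem wl) mem_enum !inE eqxx.
rewrite -(perm_size wl); under eq_bigr do rewrite path_insert //.
case: ifP => _ /=; last by rewrite big1.
have -> : #|low_nbrs m W t| = count (fun u => edge_up m u t) (b :: w).
  by rewrite (count_uniq_set _ Ubw wW).
rewrite -sum_insert_positions big_distrl /= [RHS]big_mkcond /=.
apply: eq_bigr => i _; case: ifP => // _; rewrite -exprD; congr (_ ^+ _).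
rewrite -[(_ + _)%N]/(word_inv (b :: insert_at t w i)) /insert_at -cat_cons.
rewrite word_inv_insert; last first.
  apply/allP => u; rewrite inE => ub; apply: (allP wt); rewrite inE.
  by case/orP: ub => [->//|/mem_take ->]; rewrite orbT.
by rewrite cat_cons cat_take_drop addnC.
Qed.

End Words.

(** * Orbits of permutations as words *)

Lemma mem_porbit_orbit (T : finType) (s : {perm T}) x y :
  (y \in porbit s x) = (y \in fingraph.orbit s x).
Proof.
apply/porbitP/idP => [[i ->]|].
  by rewrite permX -fconnect_orbit fconnect_iter.
by rewrite -fconnect_orbit => /iter_findex <-; exists (findex s x y); rewrite permX.
Qed.

Lemma orbit_cons (T : finType) (f : T -> T) x :
  fingraph.orbit f x = x :: behead (fingraph.orbit f x).
Proof. by rewrite /fingraph.orbit -orderSpred. Qed.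

Lemma orbit_fcycle (T : finType) (f : T -> T) x p :
  fcycle f (x :: p) -> uniq (x :: p) -> fingraph.orbit f x = x :: p.
Proof. by move=> cf Up; rewrite -(undup_cycle_cons cf) undup_id. Qed.

Lemma orbit_eq_in (T : finType) (s s' : {perm T}) (C : {set T}) x :
  (forall y, y \in C -> s y = s' y) -> (forall y, y \in C -> s y \in C) ->
  x \in C -> fingraph.orbit s x = fingraph.orbit s' x.
Proof.
move=> ss' sC xC; rewrite [RHS](@orbit_fcycle _ s' x (behead (fingraph.orbit s x))).
- exact: orbit_cons.
- rewrite -orbit_cons -(@eq_in_cycle _ (mem C) (frel s)).
  + exact: cycle_orbit perm_inj x.
  + by move=> y z yC zC /=; rewrite ss'.
  + apply/allP => y; rewrite -fconnect_orbit => /iter_findex <-.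
    by elim: (findex _ _ _) => //= i; apply: sC.
- by rewrite -orbit_cons orbit_uniq.
Qed.

Lemma sum_fiber_seq (I : finType) (T : eqType) (V : nmodType) (l : seq T) (h : I -> T)
    (P : pred I) (F : I -> V) : uniq l ->
  \sum_(w <- l) \sum_(i | P i && (h i == w)) F i = \sum_(i | P i && (h i \in l)) F i.
Proof.
move=> Ul; rewrite (exchange_big_dep P) /=; last by move=> w i _ /andP[].
rewrite [RHS]big_mkcondr /=; apply: eq_bigr => i Pi; rewrite Pi /=.
rewrite (eq_bigl (pred1 (h i))); last by move=> w; rewrite /= eq_sym.
rewrite big_const_seq count_uniq_mem //.
by case: (_ \in _) => //=; rewrite addr0.
Qed.

(** * Splitting off the cycle of the least element *)

Section CycleList.
Variables (n : nat) (m : 'I_n -> 'I_n).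
Hypothesis hm : hessenberg m.
Implicit Types (A B : {set 'I_n}) (s : 'S_n) (w : seq 'I_n) (b u v : 'I_n).
Local Notation next_ok := [rel u v : 'I_n | (v <= m u)%N].

Definition cycle_min s i := [forall j in porbit s i, (i <= j)%N].

(** The blocks of [cycle_word], restricted to cycles whose least element is in B, so that the first
    cycle can be removed. *)
Definition cycle_list B s : seq (seq 'I_n) :=
  [seq fingraph.orbit s i | i <- enum 'I_n & (i \in B) && cycle_min s i].

Lemma cycle_wordE s : cycle_word s = flatten (cycle_list setT s).
Proof.
by rewrite /cycle_word /cycle_list; congr (flatten (map _ _)); apply: eq_filter => i; rewrite inE.
Qed.

Lemma perm_onI B s : (forall u, u \notin B -> s u = u) -> perm_on B s.
Proof.
move=> h; apply/subsetP => u; rewrite unfold_in /=.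
by apply: contraR => /h ->.
Qed.

(** Each list is indexed by the increasing sequence of cycle minima, so it is enough that b is the
    least of them and that s and s' have the same cycles on B - A. *)
Lemma cycle_listD B b s s' : b \in B -> (forall u, u \in B -> (b <= u)%N) ->
  let A := [set x in fingraph.orbit s b] in
  perm_on B s -> (forall u, u \in B :\: A -> s' u = s u) ->
  cycle_list B s = fingraph.orbit s b :: cycle_list (B :\: A) s'.
Proof.
move=> bB minb A sB ss'.
have AE u : (u \in A) = (u \in porbit s b) by rewrite inE mem_porbit_orbit.
have sA u : (s u \in A) = (u \in A).
  by rewrite !AE -!eq_porbit_mem -[s u]/((s ^+ 1)%g u) porbit_perm.
have stab u : u \in B :\: A -> s u \in B :\: A.
  by rewrite !in_setD sA (perm_closed _ sB).
have orbE u : u \in B :\: A -> fingraph.orbit s u = fingraph.orbit s' u.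
  by apply: orbit_eq_in => // y yC; rewrite ss'.
have minE u : u \in B :\: A -> cycle_min s u = cycle_min s' u.
  by move=> uBA; apply: eq_forallb => j; rewrite !mem_porbit_orbit orbE.
pose P i := (i \in B) && cycle_min s i.
pose P' i := (i \in B :\: A) && cycle_min s' i.
have sorted_enum p : sorted (relpre val ltn) [seq i <- enum 'I_n | p i].
  apply: sorted_filter; first by move=> ? ? ?; apply: ltn_trans.
  by rewrite -sorted_map val_enum_ord iota_ltn_sorted.
have mem_enum_filter (p : pred 'I_n) i : (i \in [seq i <- enum 'I_n | p i]) = p i.
  by rewrite mem_filter mem_enum andbT.
have bP i : P' i -> (b < i)%N.
  rewrite /P' inE => /andP[/andP[iA iB] _]; rewrite ltn_neqAle minb // andbT.
  by apply: contraNneq iA => /val_inj <-; rewrite AE porbit_id.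
have -> : cycle_list B s = [seq fingraph.orbit s i | i <- b :: filter P' (enum 'I_n)].
  congr map; apply: (@irr_sorted_eq _ (relpre val ltn)).
  - by move=> ? ? ?; apply: ltn_trans.
  - by move=> i; rewrite /= ltnn.
  - exact: sorted_enum.
  - rewrite /= path_min_sorted ?sorted_enum //.
    by apply/allP => i; rewrite mem_filter => /andP[/bP].
  - move=> i; rewrite in_cons !mem_enum_filter -/(P i).
    have [->|ib] /= := eqVneq i b.
      rewrite /P bB; apply/forallP => j; apply/implyP.
      rewrite -(AE j) inE -fconnect_orbit => /iter_findex <-; apply: minb.
      by elim: (findex _ _ _) => //= k; rewrite (perm_closed _ sB).
    rewrite /P /P' inE; have [iA|iA] /= := boolP (i \in A); last first.
      have [iB|//] := boolP (i \in B).
      by rewrite minE // inE iA iB.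
    apply: contraNF ib => /andP[iB /forallP/(_ b)].
    rewrite porbit_sym -AE iA /= => ib; apply/eqP/val_inj/eqP.
    by rewrite eqn_leq ib minb.
rewrite map_cons; congr (_ :: _); rewrite /cycle_list -/P'.
by apply/eq_in_map => i; rewrite mem_filter => /andP[/andP[/orbE]].
Qed.

(** The cycle that reads w; it fixes every point outside w, by [next_notin]. *)
Definition cycle_perm w (Uw : uniq w) : 'S_n := perm (can_inj (prev_next Uw)).

Lemma cycle_permE w (Uw : uniq w) u : cycle_perm Uw u = next w u.
Proof. by rewrite permE. Qed.

Lemma next_notin w u : u \notin w -> next w u = u.
Proof. by rewrite next_nth => /negbTE ->. Qed.

Section Split.
Variables (B : {set 'I_n}) (b : 'I_n) (w : seq 'I_n).
Hypothesis Uw : uniq (b :: w).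
Let A := [set x in b :: w].
Hypothesis AB : A \subset B.
Let c := cycle_perm Uw.

Let AE u : (u \in A) = (u \in b :: w).
Proof. by rewrite /A in_set. Qed.

Lemma cycle_perm_fix s : (forall u, u \in A -> s u = u) ->
  forall u, (c * s)%g u = if u \in A then next (b :: w) u else s u.
Proof.
move=> sA u; rewrite permM cycle_permE; case: (boolP (u \in A)) => uA.
  by rewrite sA // AE mem_next -AE.
by rewrite next_notin // -AE.
Qed.

Lemma cycle_perm_orbit s : (forall u, u \in A -> s u = u) ->
  fingraph.orbit (c * s)%g b = b :: w.
Proof.
move=> sA; apply: orbit_fcycle => //.
rewrite -(@eq_in_cycle _ (mem A) (frel (next (b :: w)))) ?cycle_next //.
  by move=> u v uA _; rewrite /= (cycle_perm_fix sA) uA.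
by apply/allP => u; rewrite -AE.
Qed.

(** The product applies c first. Multiplication by c thus matches the permutations of B - A with
    those of B whose cycle through b reads b :: w. *)
Lemma perm_on_cycle_mul s :
  perm_on B (c * s)%g && (fingraph.orbit (c * s)%g b == b :: w) = perm_on (B :\: A) s.
Proof.
apply/andP/idP => [[sB /eqP e]|sBA].
  have nx u : u \in A -> (c * s)%g u = next (b :: w) u.
    rewrite AE => uA; have cyc : fcycle (c * s)%g (b :: w).
      by rewrite -e; apply: cycle_orbit perm_inj b.
    exact/eqP/(next_cycle cyc uA).
  apply: perm_onI => u uBA.
  have [uA|uA] := boolP (u \in A).
    have := nx (prev (b :: w) u); rewrite AE mem_prev -AE permM cycle_permE next_prev //.
    by move=> ->.
  have uB : u \notin B by rewrite inE uA in uBA.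
  have := out_perm sB uB; rewrite permM cycle_permE next_notin; first by move=> ->.
  by rewrite -AE.
have sA u : u \in A -> s u = u by move=> uA; apply: (out_perm sBA); rewrite inE uA.
split; last by rewrite cycle_perm_orbit.
apply: perm_onI => u uB; rewrite (cycle_perm_fix sA).
rewrite ifN; last by apply: contra uB; apply/subsetP.
by rewrite (out_perm sBA) // inE negb_and uB orbT.
Qed.

(** On A the condition amounts to the path condition and the closing step to b, which holds as b is
    least and u <= m u; elsewhere the product agrees with s. *)
Lemma perm_le_cycle_mul s : (forall u, u \in A -> (b <= u)%N) ->
  path next_ok b w -> perm_on (B :\: A) s -> perm_le (c * s)%g m = perm_le s m.
Proof.
move=> minb bw sBA; have [_ mge] := hm.
have sA u : u \in A -> s u = u by move=> uA; apply: (out_perm sBA); rewrite inE uA.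
apply/forallP/forallP => h u.
  have [uA|uA] := boolP (u \in A); first by rewrite sA.
  by have := h u; rewrite (cycle_perm_fix sA) (negbTE uA).
rewrite (cycle_perm_fix sA); case: ifP => // uA.
apply: (@next_cycle _ next_ok); last by rewrite -AE.
rewrite /= rcons_path bw /=; apply: leq_trans (mge _); apply: minb.
by rewrite AE mem_last.
Qed.

End Split.

Lemma cycle_list_perm B s : perm_on B s -> perm_eq (flatten (cycle_list B s)) (enum B).
Proof.
have [k] := ubnP #|B|; elim: k B s => // k IH B s Bk sB.
have [B0|[b0 b0B]] := set_0Vmem B.
  rewrite B0 enum_set0 /cycle_list (eq_filter (a2 := pred0)) ?filter_pred0 //.
  by move=> i; rewrite inE.
have [b bB minb] : exists2 b, b \in B & forall u, u \in B -> (b <= u)%N.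
  by case: (@arg_minnP _ b0 (mem B) (fun u => u : nat) b0B) => b bB h; exists b.
set w := behead (fingraph.orbit s b).
have ow : fingraph.orbit s b = b :: w := orbit_cons _ _.
have Uw : uniq (b :: w) by rewrite -ow orbit_uniq.
pose s' := ((cycle_perm Uw)^-1 * s)%g.
have sE : s = (cycle_perm Uw * s')%g by rewrite mulKVg.
set A := [set x in b :: w].
have bA : b \in A by rewrite inE mem_head.
have AB : A \subset B.
  apply/subsetP => u; rewrite inE -ow -fconnect_orbit => /iter_findex <-.
  by elim: (findex _ _ _) => //= i; rewrite (perm_closed _ sB).
have s'BA : perm_on (B :\: A) s' by rewrite -(perm_on_cycle_mul Uw AB) -sE sB ow eqxx.
have AE : [set x in fingraph.orbit s b] = A by rewrite ow.
have s'E u : u \in B :\: A -> s' u = s u.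
  rewrite sE => uBA; rewrite (@cycle_perm_fix _ _ Uw s') ?ifN //.
    by move: uBA; rewrite inE => /andP[].
  by move=> v vA; apply: (out_perm s'BA); rewrite inE vA.
rewrite (cycle_listD bB minb sB (s' := s')) AE //= ow.
have -> : perm_eq ((b :: w) ++ flatten (cycle_list (B :\: A) s')) (enum B) =
    perm_eq ((b :: w) ++ enum (B :\: A)) (enum B).
  apply: permPl; rewrite perm_cat2l; apply: IH => //.
  apply: leq_trans (_ : #|B| <= _)%N => //; apply: proper_card.
  by rewrite properE subsetDl; apply/subsetPn; exists b; rewrite // !inE eqxx.
apply: uniq_perm; rewrite ?enum_uniq //.
  rewrite cat_uniq Uw enum_uniq andbT /=; apply/hasPn => u; rewrite mem_enum !inE.
  by case/andP.
move=> u; rewrite mem_cat !mem_enum in_setD [u \in A]inE.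
case: (boolP (u \in b :: w)) => //= uA; apply/esym/(subsetP AB).
by rewrite inE.
Qed.

(** A permutation of B is given by the support A of its cycle through b, the word b :: w of that
    cycle and a permutation of B - A. Here f stands for any weight that depends only on the list of
    cycles. *)
Lemma cycle_sum (V : nmodType) (f : seq (seq 'I_n) -> V) B b :
  b \in B -> (forall u, u \in B -> (b <= u)%N) ->
  \sum_(s : 'S_n | perm_on B s && perm_le s m) f (cycle_list B s) =
  \sum_(A : {set 'I_n} | (A \subset B) && (b \in A))
    \sum_(w <- permutations (enum (A :\ b)) | path next_ok b w)
      \sum_(s : 'S_n | perm_on (B :\: A) s && perm_le s m)
        f ((b :: w) :: cycle_list (B :\: A) s).
Proof.
move=> bB minb.
rewrite (partition_big (fun s : 'S_n => [set x in fingraph.orbit s b])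
   (fun A => (A \subset B) && (b \in A))) /=; last first.
  move=> s /andP[sB _]; rewrite inE in_orbit andbT.
  apply/subsetP => u; rewrite inE -fconnect_orbit => /iter_findex <-.
  by elim: (findex _ _ _) => //= i; rewrite (perm_closed _ sB).
apply: eq_bigr => A /andP[AB bA].
rewrite (eq_bigl (fun s : 'S_n => (perm_on B s && perm_le s m) &&
    (behead (fingraph.orbit s b) \in permutations (enum (A :\ b))))); last first.
  move=> s; congr (_ && _); rewrite mem_permutations.
  have := orbit_uniq s b; rewrite orbit_cons /= => /andP[bw Uw].
  apply/eqP/idP => [<-|pw].
    apply: uniq_perm; rewrite ?enum_uniq // => u; rewrite mem_enum !inE.
    by case: eqP => //= ->; rewrite (negbTE bw).
  apply/setP => u; rewrite !inE (perm_mem pw) mem_enum !inE.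
  by case: eqP => //= ->; rewrite bA.
rewrite -sum_fiber_seq ?permutations_uniq // [RHS]big_mkcond.
apply: eq_big_seq => w; rewrite mem_permutations => pw.
have Uw : uniq (b :: w).
  by rewrite /= (perm_uniq pw) enum_uniq (perm_mem pw) mem_enum !inE eqxx.
have AE : [set x in b :: w] = A.
  apply/setP => u; rewrite !inE (perm_mem pw) mem_enum !inE.
  by case: eqP => //= ->; rewrite bA.
have ow s : (behead (fingraph.orbit s b) == w) = (fingraph.orbit s b == b :: w).
  by rewrite orbit_cons eqseq_cons eqxx.
(* A word that breaks the path condition is the cycle of no permutation satisfying [perm_le]. *)
case: ifP => bw; last first.
  rewrite big_pred0 // => s; apply: contraFF bw => /andP[/andP[_ /forallP sm]].
  rewrite ow => /eqP e; have := cycle_orbit perm_inj b (f := s); rewrite e /=.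
  rewrite rcons_path => /andP[+ _]; apply: sub_path => u v /eqP <- /=.
  exact: sm.
rewrite (reindex_inj (mulgI (cycle_perm Uw))) /=.
have AB' : [set x in b :: w] \subset B by rewrite AE.
have minA u : u \in [set x in b :: w] -> (b <= u)%N.
  by rewrite AE => /(subsetP AB)/minb.
apply: eq_big => [s|s].
  rewrite ow andbAC (perm_on_cycle_mul Uw AB') AE; apply: andb_id2l => sBA.
  by rewrite (@perm_le_cycle_mul B) // AE.
rewrite ow andbAC (perm_on_cycle_mul Uw AB') AE => /andP[sBA _]; congr f.
have /andP[sB /eqP os] : perm_on B (cycle_perm Uw * s)%g &&
    (fingraph.orbit (cycle_perm Uw * s)%g b == b :: w).
  by rewrite (perm_on_cycle_mul Uw AB') AE.
have AE' : [set x in fingraph.orbit (cycle_perm Uw * s)%g b] = A by rewrite os.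
rewrite (cycle_listD bB minb sB (s' := s)) AE' ?os // => u uBA.
rewrite cycle_perm_fix AE; first by rewrite ifN //; move: uBA; rewrite inE => /andP[].
by move=> v vA; apply: (out_perm sBA); rewrite inE vA.
Qed.

End CycleList.

(** * The recursion for the sum over permutations *)

Section PermSum.
Variables (n : nat) (m : 'I_n -> 'I_n).
Hypothesis hm : hessenberg m.
Variables (R : idomainType) (q : R) (x : nat -> R) (N : nat) (r : nat -> R).
Hypothesis q_neq1 : q - 1 != 0.
Hypothesis rE : forall k, (q - 1) * r k.+1 = quot_coef q x N.+1 k.+1.
Implicit Types (A B : {set 'I_n}).

Definition perm_sum B : R :=
  \sum_(s : 'S_n | perm_on B s && perm_le s m)
    q ^+ word_inv m (flatten (cycle_list B s)) *
    \prod_(w <- cycle_list B s) r (size w).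

Lemma perm_sum_set0 : perm_sum set0 = 1.
Proof.
have cl0 s : cycle_list set0 s = [::] :> seq (seq 'I_n).
  rewrite /cycle_list (eq_filter (a2 := pred0)) ?filter_pred0 //.
  by move=> i; rewrite inE.
rewrite /perm_sum (big_pred1 1%g) => [|s]; first by rewrite cl0 big_nil expr0 mulr1.
apply/andP/eqP => [[s0 _]|->]; first by apply: (perm_on_id s0); rewrite cards0.
rewrite perm_on1; split=> //; apply/forallP => i; rewrite perm1.
by have [_] := hm.
Qed.

(** The inversions split into those of the first cycle, those of the rest and inv(A, B - A) between
    them; summing over the first cycle gives c(A). *)
Lemma perm_sum_cycle B b : b \in B -> (forall u, u \in B -> (b <= u)%N) ->
  perm_sum B = \sum_(A : {set 'I_n} | A \subset B)
    (if b \in A then cyc_weight m q b A * q ^+ back_inv m A (B :\: A) * r #|A| *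
       perm_sum (B :\: A) else 0).
Proof.
move=> bB minb.
rewrite /perm_sum (cycle_sum hm (fun L => q ^+ word_inv m (flatten L) *
  \prod_(w <- L) r (size w)) bB minb) big_mkcondr /=.
apply: eq_bigr => A AB; case: ifP => // bA.
have minA u : u \in A -> (b <= u)%N by move=> /(subsetP AB)/minb.
rewrite -(sum_words hm q bA minA) !big_distrl big_seq_cond [RHS]big_seq_cond.
apply: eq_bigr => w /andP[]; rewrite mem_permutations => pw _.
rewrite big_distrr; apply: eq_bigr => s /andP[sBA _].
have pl := cycle_list_perm sBA.
have Uw : uniq (b :: w).
  by rewrite /= (perm_uniq pw) enum_uniq (perm_mem pw) mem_enum !inE eqxx.
have wA : (b :: w) =i A.
  move=> u; rewrite !inE (perm_mem pw) mem_enum !inE.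
  by case: eqP => //= ->; rewrite bA.
have -> : #|A| = size (b :: w).
  by rewrite -(card_uniqP Uw); apply: eq_card => u; rewrite wA.
rewrite big_cons -[(count _ _ + _)%N]/(word_inv m ((b :: w) ++ flatten (cycle_list (B :\: A) s))).
rewrite (word_inv_cat m Uw _ wA (B := B :\: A)); last first.
- by move=> u; rewrite (perm_mem pl) mem_enum.
- by rewrite (perm_uniq pl) enum_uniq.
by rewrite !exprD /=; ring.
Qed.

(** Both sides satisfy the recursion of [csf_on_cycle], once the factor q - 1 is cancelled in the
    domain R. *)
Lemma perm_sum_csf B : perm_sum B = csf_on m q x N N.+1 B.
Proof.
have [k] := ubnP #|B|; elim: k B => // k IH B Bk.
have [->|[b0 b0B]] := set_0Vmem B; first by rewrite perm_sum_set0 csf_on_set0.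
have [b bB minb] : exists2 b, b \in B & forall u, u \in B -> (b <= u)%N.
  by case: (@arg_minnP _ b0 (mem B) (fun u => u : nat) b0B) => b bB h; exists b.
apply: (mulfI q_neq1); rewrite (csf_on_cycle hm q x (leqnn _) bB minb).
rewrite (perm_sum_cycle bB minb) big_distrr /=; apply: eq_bigr => A AB.
case: ifP => bA; last by rewrite mulr0.
have lt : (#|B :\: A| < k)%N.
  apply: leq_trans (_ : #|B| <= _)%N => //; apply: proper_card.
  by rewrite properE subsetDl; apply/subsetPn; exists b; rewrite // !inE bA.
have A0 : #|A| = #|A|.-1.+1 by rewrite prednK // card_gt0; apply/set0Pn; exists b.
by rewrite (IH _ lt) A0 -rE; ring.
Qed.

End PermSum.

(** * Elementary symmetric polynomials and the quotient *)

Section Elementary.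
Variables (R : comNzRingType) (q : R) (x : nat -> R) (N : nat).

(** This is e_k(x_0, ..., x_(j-1)); the index type stays ['I_N] while j varies. *)
Definition elem j k : R :=
  \sum_(h : {set 'I_N} | h \subset [set i : 'I_N | (i < j)%N])
    (if #|h| == k then \prod_(i in h) x i else 0).

Lemma elem0 j : elem j 0 = 1.
Proof.
rewrite /elem (bigD1 set0) ?sub0set //= cards0 big_set0 big1 ?addr0 // => h /andP[_ h0].
by rewrite cards_eq0 (negbTE h0).
Qed.

Lemma elem_nil k : elem 0 k.+1 = 0.
Proof.
rewrite /elem big1 // => h /subsetP h0; rewrite ifF //.
have -> : h = set0 by apply/setP => i; rewrite inE; apply/negP => /h0; rewrite inE.
by rewrite cards0.
Qed.

Lemma elemS j k : (j < N)%N -> elem j.+1 k.+1 = elem j k.+1 + x j * elem j k.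
Proof.
move=> jN; pose c : 'I_N := Ordinal jN; rewrite /elem.
have -> : [set i : 'I_N | (i < j.+1)%N] = c |: [set i : 'I_N | (i < j)%N].
  by apply/setP => i; rewrite !inE ltnS leq_eqVlt -val_eqE.
rewrite big_subset_setU1 ?inE ?ltnn // big_split addrC big_distrr /=; congr (_ + _).
apply: eq_bigr => h /subsetP hj.
have ch : c \notin h by apply/negP => /hj; rewrite inE ltnn.
by rewrite cardsU1 ch add1n eqSS big_setU1 //=; case: ifP => // _; rewrite mulr0.
Qed.

Let conv (f g : nat -> R) k := \sum_(i < k.+1) f (k - i)%N * g i.

Let conv_recl f g k : conv f g k.+1 = f k.+1 * g 0%N + conv f (g \o succn) k.
Proof. by rewrite /conv big_ord_recl subn0. Qed.

Let conv_recr f g k : conv f g k.+1 = conv (f \o succn) g k + f 0%N * g k.+1.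
Proof.
rewrite /conv big_ord_recr /= subnn; congr (_ + _).
by apply: eq_bigr => i _; rewrite /= subSn // -ltnS.
Qed.

(** The coefficient form of E(z) Q(z) = E(qz), with Q the generating function of [quot_coef]. *)
Lemma elem_quot j k : (j <= N)%N ->
  \sum_(i < k.+1) elem j (k - i)%N * quot_coef q x j i = q ^+ k * elem j k.
Proof.
elim: j k => [|j IH] k jN.
  rewrite big_ord_recl /= subn0 quot_coef_nil mulr1 big1 => [|i _].
    by case: k => [|k]; rewrite ?elem_nil ?mulr0 ?addr0 // expr0 mul1r.
  by rewrite quot_coef_nil mulr0.
case: k => [|k]; first by rewrite big_ord1 quot_coef0 expr0 mulr1 mul1r.
have {}IH l : conv (elem j) (quot_coef q x j) l = q ^+ l * elem j l := IH l (ltnW jN).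
rewrite -[LHS]/(conv (elem j.+1) (quot_coef q x j.+1) k.+1).
set e := elem j in IH *; set g := quot_coef q x j in IH *; set g' := quot_coef q x j.+1.
(* The factor 1 + x_j z is moved from E to the quotient, where [quot_coefS] turns it into 1 + q x_j
   z. *)
have -> : conv (elem j.+1) g' k.+1 = conv e g' k.+1 + x j * conv e g' k.
  have e0 : e 0%N = 1 := elem0 j.
  rewrite !conv_recr elem0 e0 mul1r addrAC; congr (_ + _).
  rewrite /conv big_distrr -big_split; apply: eq_bigr => i _ /=.
  by rewrite elemS // mulrDl mulrA.
rewrite conv_recl -addrA.
have -> : conv e (g' \o succn) k + x j * conv e g' k =
    conv e (g \o succn) k + q * x j * conv e g k.
  rewrite /conv !big_distrr -!big_split; apply: eq_bigr => i _ /=.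
  by rewrite !(mulrCA _ (e _)) -!mulrDr quot_coefS.
rewrite addrA {1}/g' quot_coef0 -[1](quot_coef0 q x j) -conv_recl !IH elemS // exprS -/e.
ring.
Qed.

End Elementary.

(** * The involution omega *)

(* Unlike [omega f = g], this is stable under ring operations without any     *)
(* symmetry assumption.                                                       *)
Definition omega_pair (R : comNzRingType) (f g : limpoly R) :=
  exists M (t : {mpoly R[M]}), f = limeval (@sym_e R) t /\ g = limeval (@sym_h R) t.

Section OmegaPair.
Variable R : comNzRingType.
Implicit Types f g : limpoly R.

Lemma omega_pairE f g : omega_pair f g -> omega f = g.
Proof. by move=> [M [t [-> ->]]]; apply: omega_limeval. Qed.

Lemma omega_pair2 f g f' g' : omega_pair f g -> omega_pair f' g' ->
  exists M (t t' : {mpoly R[M]}),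
    [/\ f = limeval (@sym_e R) t, g = limeval (@sym_h R) t,
        f' = limeval (@sym_e R) t' & g' = limeval (@sym_h R) t'].
Proof.
move=> [M [t [-> ->]]] [M' [t' [-> ->]]].
exists (maxn M M'), (mwide (leq_maxl M M') t), (mwide (leq_maxr M M') t').
by rewrite !limeval_mwide.
Qed.

Lemma omega_pairD f g f' g' : omega_pair f g -> omega_pair f' g' ->
  omega_pair (f + f') (g + g').
Proof.
move=> h /(omega_pair2 h)[M [t [t' [-> -> -> ->]]]].
by exists M, (t + t'); rewrite !limevalD.
Qed.

Lemma omega_pairM f g f' g' : omega_pair f g -> omega_pair f' g' ->
  omega_pair (f * f') (g * g').
Proof.
move=> h /(omega_pair2 h)[M [t [t' [-> -> -> ->]]]].
by exists M, (t * t'); rewrite !limevalM.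
Qed.

Lemma omega_pairZ c f g : omega_pair f g -> omega_pair (c *: f) (c *: g).
Proof. by move=> [M [t [-> ->]]]; exists M, (c *: t); rewrite !limevalZ. Qed.

Lemma omega_pair0 : omega_pair (0 : limpoly R) 0.
Proof. by exists 0%N, 0; split; rewrite /limeval raddf0. Qed.

Lemma omega_pair1 : omega_pair (1 : limpoly R) 1.
Proof. by exists 0%N, 1; split; rewrite limeval1. Qed.

Lemma sym_e0 : sym_e R 0 = 1.
Proof. by apply: limpolyP => N; apply: mesym0E. Qed.

Lemma sym_h0 : sym_h R 0 = 1.
Proof.
apply: limpolyP => N; apply/mpolyP => k.
by rewrite mcoeff_mhsym mdeg_eq0 mcoeff1 eq_sym.
Qed.

Lemma omega_pair_sym k : omega_pair (sym_e R k) (sym_h R k).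
Proof.
case: k => [|k]; first by rewrite sym_e0 sym_h0; apply: omega_pair1.
by exists k.+1, 'X_ord_max; rewrite !limevalX.
Qed.

Lemma omega_pair_sum (I : Type) (s : seq I) (P : pred I) (F F' : I -> limpoly R) :
  (forall i, P i -> omega_pair (F i) (F' i)) ->
  omega_pair (\sum_(i <- s | P i) F i) (\sum_(i <- s | P i) F' i).
Proof.
by move=> h; elim/big_rec2: _ => [|i f g /h]; [exact: omega_pair0|exact: omega_pairD].
Qed.

Lemma omega_pair_prod (I : Type) (s : seq I) (P : pred I) (F F' : I -> limpoly R) :
  (forall i, P i -> omega_pair (F i) (F' i)) ->
  omega_pair (\prod_(i <- s | P i) F i) (\prod_(i <- s | P i) F' i).
Proof.
by move=> h; elim/big_rec2: _ => [|i f g /h]; [exact: omega_pair1|exact: omega_pairM].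
Qed.

End OmegaPair.

(** * Preimages of the rho under omega *)

Fixpoint erho_seq n : seq (limpoly Zq) :=
  if n is k.+1 then
    rcons (erho_seq k) (qint k.+1 *: sym_e _ k.+1
                       - \sum_(i < k) sym_e _ (k - i) * (erho_seq k)`_i)
  else [::].

(** The recursion of [rho] with e in place of h, so that omega sends [erho n] to [rho n], as
    [omega_pair_rho] shows. *)
Definition erho n : limpoly Zq := (erho_seq n)`_n.-1.

Lemma size_erho_seq n : size (erho_seq n) = n.
Proof. by elim: n => //= n IH; rewrite size_rcons IH. Qed.

Lemma nth_erho_seq n i : (i < n)%N -> (erho_seq n)`_i = erho i.+1.
Proof.
elim: n => //= n IH; rewrite ltnS leq_eqVlt => /predU1P[->//|ltin].
by rewrite nth_rcons size_erho_seq ltin IH.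
Qed.

Lemma erhoE n :
  qint n.+1 *: sym_e _ n.+1 = \sum_(i < n.+1) sym_e _ (n - i) * erho i.+1.
Proof.
rewrite big_ord_recr /= subnn sym_e0 mul1r {2}/erho /= nth_rcons size_erho_seq ltnn eqxx.
rewrite [X in X + _](eq_bigr (fun i : 'I_n => sym_e Zq (n - i) * (erho_seq n)`_i)).
  by rewrite addrC subrK.
by move=> i _; rewrite nth_erho_seq.
Qed.

Lemma omega_pair_rho k : omega_pair (erho k) (rho k).
Proof.
suff h i : omega_pair (erho_seq k)`_i (rho_seq k)`_i by apply: h.
elim: k i => [|k IH] i /=; first by rewrite nth_nil; apply: omega_pair0.
rewrite !nth_rcons size_erho_seq size_rho_seq.
case: ltngtP => _; [exact: IH|exact: omega_pair0|].
apply: omega_pairD; first by apply/omega_pairZ/omega_pair_sym.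
rewrite -!scaleN1r; apply: omega_pairZ; apply: omega_pair_sum => i' _.
by apply: omega_pairM; [exact: omega_pair_sym|exact: IH].
Qed.

(** Each cycle has exactly one least element, so listing orbits by cycle minima runs once through
    [porbits s]. *)
Lemma cycle_type_list n (s : 'S_n) :
  perm_eq (cycle_type s) [seq size w | w <- cycle_list setT s].
Proof.
rewrite /= perm_sort -map_comp.
have -> : [seq (size \o fingraph.orbit s) i | i <- enum 'I_n & (i \in [set: 'I_n]) && cycle_min s i]
  = [seq #|C| | C : {set 'I_n} <- [seq porbit s i | i <- enum 'I_n & cycle_min s i]].
  rewrite -map_comp (eq_filter (a2 := cycle_min s)); last by move=> i; rewrite inE.
  apply: eq_map => i /=.
  rewrite -(card_uniqP (orbit_uniq s i)); apply: eq_card => j.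
  by rewrite mem_porbit_orbit.
apply: perm_map; apply: uniq_perm; rewrite ?enum_uniq //.
  rewrite map_inj_in_uniq => [|i j]; first exact/filter_uniq/enum_uniq.
  rewrite !mem_filter => /andP[/forallP mi _] /andP[/forallP mj _] e.
  apply/val_inj/eqP; rewrite eqn_leq.
  have := mi j; rewrite e porbit_id /= => ->.
  by have := mj i; rewrite -e porbit_id.
move=> C; rewrite mem_enum; apply/imsetP/mapP => [[i _ ->]|[i _ ->]]; last by exists i.
have ii : i \in porbit s i := porbit_id s i.
case: (@arg_minnP _ i (mem (porbit s i)) (fun u => u : nat) ii) => j ji jmin.
have e : porbit s j = porbit s i by apply/eqP; rewrite eq_porbit_mem.
exists j => //; rewrite mem_filter mem_enum andbT.
by apply/forallP => k; apply/implyP; rewrite e; apply: jmin.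
Qed.

(** * The expansion in N + 1 variables *)

Section Truncation.
Variables (n : nat) (m : 'I_n -> 'I_n).
Hypothesis hm : hessenberg m.
Variable N : nat.
Local Notation R := {mpoly Zq[N.+1]}.
Let q : R := ('X : Zq)%:MP.
Let x (i : nat) : R := 'X_(inord i).

Lemma mesym_elem k : mesym N.+1 Zq k = elem x N.+1 N.+1 k.
Proof.
rewrite /mesym /elem big_mkcond /=; apply: eq_big => [h|h _].
  by apply/esym/subsetP => i _; rewrite inE ltn_ord.
by case: ifP => // _; apply: eq_bigr => i _; rewrite /x inord_val.
Qed.

Lemma csfq_truncE : csfq_trunc (indiff m) N.+1 = csf_on m q x N N.+1 setT.
Proof.
rewrite /csfq_trunc /csf_on; apply: eq_big => [k|k _].
  apply/forallP/colors_onP => [h|[_ _ h] u].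
    split=> [v _|v|u v _ _ uv]; [exact: ltn_ord|by rewrite inE|].
    by have /forallP/(_ v)/implyP := h u; apply; rewrite indiffE uv.
  apply/forallP => v; apply/implyP; rewrite indiffE => /orP[]/h; rewrite !inE => /(_ isT isT) //.
  by rewrite eq_sym.
rewrite -mul_mpolyC rmorphXn; congr (_ ^+ _ * _).
  rewrite /asc /asc_on.
  rewrite -sum1dep_card; transitivity (\sum_(u : 'I_n) \sum_(v : 'I_n)
      [&& (u < v)%N, (k u < k v)%N & indiff m u v] : nat)%N.
    by rewrite pair_bigA big_mkcond /=; apply: eq_bigr => -[u v] _.
  rewrite exchange_big /= [RHS](eq_bigl predT) => [|v]; last by rewrite inE.
  apply: eq_bigr => v _; rewrite -sum1dep_card big_mkcond [RHS]big_mkcond /=.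
  apply: eq_bigr => u _; rewrite !inE /= indiffE.
  case: (ltnP u v) => [uv|vu] /=; last by rewrite (edge_upF m vu).
  by rewrite (edge_upF m (ltnW uv)) orbF andbC; case: (_ && _).
rewrite [RHS](eq_bigl predT) => [|v]; last by rewrite inE.
by apply: eq_bigr => v _; rewrite /x inord_val.
Qed.

(** Since (q - 1) [k+1]_q = q^(k+1) - 1, multiplying [erhoE] by q - 1 gives the triangular system
    that [elem_quot] gives for the quotient coefficients; its diagonal entries are e_0 = 1. *)
Lemma erho_quot k : (q - 1) * erho k.+1 N.+1 = quot_coef q x N.+1 k.+1.
Proof.
have [l] := ubnP k; elim: l k => // l IH k kl.
have := elem_quot q x k.+1 (leqnn N.+1); rewrite big_ord_recl /= subn0 quot_coef0 mulr1.
rewrite -!mesym_elem.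
have := congr1 (truncN N.+1) (erhoE k).
rewrite linearZ /= rmorph_sum /= -mul_mpolyC.
have -> : (qint k.+1)%:MP_[N.+1] = qnum q k.+1.
  by rewrite /qint /qnum rmorph_sum; apply: eq_bigr => i _; rewrite rmorphXn.
move=> e1 e2.
have {e2} : (q - 1) * (qnum q k.+1 * mesym N.+1 Zq k.+1) =
    \sum_(i < k.+1) mesym N.+1 Zq (k - i) * quot_coef q x N.+1 i.+1.
  move: e2; rewrite qnum_exp mulrDl mul1r mulrA => /addrI <-.
  by apply: eq_bigr => i _; rewrite /bump /= add1n subSS -mesym_elem.
rewrite e1 !big_ord_recr /= subnn mulrDr big_distrr /=.
rewrite mesym0E !mul1r.
rewrite [X in X + _ = _](eq_bigr (fun i : 'I_k => mesym N.+1 Zq (k - i) * quot_coef q x N.+1 i.+1)).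
  by move/addrI.
move=> i _; rewrite mulrCA IH //.
by apply: leq_trans (ltn_ord i) _; rewrite -ltnS.
Qed.

Lemma csfq_trunc_perm : csfq_trunc (indiff m) N.+1 =
  \sum_(s : 'S_n | perm_le s m) ('X : Zq) ^+ wt (indiff m) s *:
     truncN N.+1 (\prod_(i <- cycle_type s) erho i).
Proof.
have q1 : q - 1 != 0.
  rewrite subr_eq0; apply/eqP => /(congr1 (mcoeff 0)); rewrite mcoeffC mcoeff1 eqxx mulr1.
  by move/(congr1 (fun p : Zq => size p)); rewrite size_polyX size_poly1.
rewrite csfq_truncE -(perm_sum_csf hm (r := fun k => erho k N.+1) q1 erho_quot) /perm_sum.
apply: eq_big => [s|s _].
  by rewrite (_ : perm_on setT s) //; apply/subsetP => u; rewrite inE.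
rewrite -mul_mpolyC rmorphXn /wt ginv_word_inv cycle_wordE; congr (_ * _).
by rewrite rmorph_prod (perm_big _ (cycle_type_list s)) [RHS]big_map.
Qed.

End Truncation.

(** * The expansion in countably many variables and its image under omega *)

Lemma csfq_perm n (m : 'I_n -> 'I_n) : hessenberg m ->
  csfq (indiff m) = \sum_(s : 'S_n | perm_le s m)
    ('X : Zq) ^+ wt (indiff m) s *: \prod_(i <- cycle_type s) erho i.
Proof.
move=> hm; set f := csfq _; set g := \sum_(s | _) _.
have fgS N : f N.+1 = g N.+1.
  rewrite [LHS](csfq_trunc_perm hm) -[RHS]/(truncN N.+1 g) linear_sum /=.
  by apply: eq_bigr.
(* The truncation to no variables is obtained from the one to a single variable by setting x_0 =
   0. *)
by apply: limpolyP => -[|N]; [rewrite -(truncP f) -(truncP g) fgS|exact: fgS].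
Qed.

Theorem theorem1p1 (n : nat) (m : 'I_n -> 'I_n) (hm : hessenberg m) :
  omega (csfq (indiff m))
    = \sum_(s : 'S_n | perm_le s m)
        ('X : Zq) ^+ wt (indiff m) s *: rho_part (cycle_type s)
  /\
  \sum_(s : 'S_n | perm_le s m)
      ('X : Zq) ^+ wt (indiff m) s *: rho_part (cycle_type s)
    = \sum_(la : intpart n) ccoef m la *: rho_part la.
Proof.
split.
  apply: omega_pairE; rewrite (csfq_perm hm); apply: omega_pair_sum => s _.
  apply: omega_pairZ; apply: omega_pair_prod => i _; exact: omega_pair_rho.
rewrite (partition_big (@cycle_type n) predT) //; apply: eq_bigr => la _.
by rewrite /ccoef scaler_suml; apply: eq_bigr => s /andP[_ /eqP ->].
Qed.
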